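(* Let $0<\alpha<1$, let $n\ge 1$ be an integer, $h=1/n$, $x_j=jh$ for $0\le j\le n$, and let $1\le k\le n$. Let $\varphi\in C^3[0,x_k]$, and let $K:[0,1]\times[0,1]\to\mathbb{R}$ be continuous with $|K(x,\tau)|\le M$ for all $0\le x,\tau\le 1$, where $M>0$. Let $G^k(\varphi,h,\alpha)$ be the error at $x_k$ of the Quadratic scheme (S2) for the equation $D^\alpha\varphi(x)=f(x)+\int_0^x K(x,\tau)\varphi(\tau)\,d\tau$. Then: (i) for $k=1$, $$\left|G^1(\varphi,h,\alpha)\right|\le\frac{\alpha}{2\Gamma(3-\alpha)}\max_{x_0\le\tau\le x_1}|\varphi''(\tau)|\,h^{2-\alpha}+\frac{M}{2}\max_{x_0\le\tau\le x_1}|\varphi''(\tau)|\,x_1h^2;$$ (ii) for $k\ge 2$, $$\begin{aligned}\left|G^k(\varphi,h,\alpha)\right|\le{}&\frac{1}{\Gamma(1-\alpha)}\left(\frac{\alpha}{12}\max_{x_0\le\tau\le x_k}|\varphi''(\tau)|\,(x_k-x_1)^{-\alpha-1}h^3+\left[\frac1{12}+\frac{\alpha}{3(1-\alpha)(2-\alpha)}\left(\frac12+\frac1{3-\alpha}\right)\right]\max_{x_0\le\tau\le x_k}|\varphi'''(\tau)|\,h^{3-\alpha}\right)\\&+\frac M2\max_{x_0\le\tau\le x_1}|\varphi''(\tau)|\,x_1h^2+\frac{M}{12}\max_{x_0\le\tau\le x_k}|\varphi'''(\tau)|\,(x_k-x_1)h^3 .\end{aligned}$$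
   Context: For $0<\alpha<1$ the Caputo derivative is $D^\alpha\varphi(x)=\frac{1}{\Gamma(1-\alpha)}\int_0^x (x-\tau)^{-\alpha}\varphi'(\tau)\,d\tau$. The problem considered is $D^\alpha\varphi(x)=f(x)+\int_0^x K(x,\tau)\varphi(\tau)\,d\tau$ on $0\le x\le 1$, with $\varphi(0)=\delta$ prescribed. Write $\varphi_j=\varphi(x_j)$. Quadratic scheme (S2): on $[x_0,x_1]$ replace $\varphi$ by the linear interpolant $$\varphi_{10}(\tau)=\frac{x_1-\tau}{h}\varphi_0+\frac{\tau-x_0}{h}\varphi_1,$$ and on each $[x_{j-1},x_j]$, $2\le j\le k$, replace $\varphi$ by the quadratic interpolant through $(x_{j-2},\varphi_{j-2}),(x_{j-1},\varphi_{j-1}),(x_j,\varphi_j)$, $$\varphi_{2j-1}(\tau)=\frac{(\tau-x_{j-1})(\tau-x_j)}{2h^2}\varphi_{j-2}-\frac{(\tau-x_{j-2})(\tau-x_j)}{h^2}\varphi_{j-1}+\frac{(\tau-x_{j-2})(\tau-x_{j-1})}{2h^2}\varphi_j ,$$ both in the Caputo derivative term (where $\varphi'$ is replaced by the derivative of the interpolant) and in the integral term of the equation at $x=x_k$. (Here $\varphi_{10}$ and $\varphi_{2j-1}$ are names of these interpolants, not nodal values.) The error of the scheme at $x_k$ is the error committed by this replacement: $$\begin{aligned}G^k(\varphi,h,\alpha)={}&\frac{1}{\Gamma(1-\alpha)}\left(\int_{x_0}^{x_1}(x_k-\tau)^{-\alpha}\left(\varphi-\varphi_{10}\right)'(\tau)\,d\tau+\sum_{j=2}^{k}\int_{x_{j-1}}^{x_j}(x_k-\tau)^{-\alpha}\left(\varphi-\varphi_{2j-1}\right)'(\tau)\,d\tau\right)\\&-\int_{x_0}^{x_1}K(x_k,\tau)\left(\varphi(\tau)-\varphi_{10}(\tau)\right)d\tau-\sum_{j=2}^{k}\int_{x_{j-1}}^{x_j}K(x_k,\tau)\left(\varphi(\tau)-\varphi_{2j-1}(\tau)\right)d\tau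 ,\end{aligned}$$ where the sums are empty when $k=1$. *)

(* Defs.v *)
From HB Require Import structures.
From mathcomp Require Import all_boot all_order all_algebra.
From mathcomp Require Import all_classical all_reals all_analysis.
Import Order.TTheory GRing.Theory Num.Theory.
Import numFieldNormedType.Exports.

Set Implicit Arguments.
Unset Strict Implicit.
Unset Printing Implicit Defensive.

Local Open Scope classical_set_scope.
Local Open Scope ring_scope.

(* Differentiability relative to A: only points of A enter the limit, so that
   for A = `[a, b] the derivatives at a and b are the one-sided ones and the
   values of f outside A are irrelevant. *)
Definition slope (R : realType) (f : R -> R) (x y : R) : R :=
  (f y - f x) / (y - x).

Definition derivable_within (R : realType) (A : set R) (f : R -> R) (x : R) :=
  cvg (slope f x y @[y --> within A x^']).

Definition derive_within (R : realType) (A : set R) (f : R -> R) (x : R) : R :=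
  lim (slope f x y @[y --> within A x^']).

Definition derive_withinn (R : realType) (A : set R) (m : nat) (f : R -> R) :
    R -> R :=
  iter m (derive_within A) f.

(* f is of class C^m on A *)
Definition class_C (R : realType) (m : nat) (A : set R) (f : R -> R) : Prop :=
  (forall i x, (i < m)%N -> A x -> derivable_within A (derive_withinn A i f) x)
  /\ (forall i, (i <= m)%N -> {within A, continuous (derive_withinn A i f)}).

(* max_{a <= t <= b} |f t|; see maxabs_max for the fact that the supremum is a
   maximum when f is continuous on [a, b]. *)
Definition maxabs (R : realType) (a b : R) (f : R -> R) : R :=
  sup [set `|f t| | t in `[a, b]].

Lemma maxabs_max (R : realType) (a b : R) (f : R -> R) :
  a <= b -> {within `[a, b], continuous f} ->
  (exists2 c, c \in `[a, b] & maxabs a b f = `|f c|) /\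
  (forall t, t \in `[a, b] -> `|f t| <= maxabs a b f).
Proof.
move=> leab cf.
have cnf : {within `[a, b], continuous (fun t => `|f t|)}.
  move=> x; apply: continuous_comp; [exact: cf|exact: norm_continuous].
have [c cab cmax] := EVT_max leab cnf.
have maxE : maxabs a b f = `|f c|.
  have ubc : ubound [set `|f t| | t in `[a, b]] `|f c|.
    by move=> _ [t tab <-]; apply: cmax; rewrite inE in tab *.
  apply/eqP; rewrite eq_le; apply/andP; split.
    apply: ge_sup => //; exists `|f c|; exists c => //.
  apply: ub_le_sup; first by exists `|f c|.
  by exists c.
by split; [exists c|move=> t tab; rewrite maxE; exact: cmax].
Qed.

Definition Gamma (R : realType) (s : R) : R :=
  Rintegral lebesgue_measure `]0, +oo[ (fun t => t `^ (s - 1) * expR (- t)).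

(* grid point x_j = j h *)
Definition node (R : realType) (h : R) (j : nat) : R := j%:R * h.

(* phi_{10}, the linear interpolant on [x_0, x_1] *)
Definition interp1 (R : realType) (h : R) (phi : R -> R) (t : R) : R :=
  (node h 1 - t) / h * phi (node h 0) + (t - node h 0) / h * phi (node h 1).

(* phi_{2j-1}, the quadratic interpolant used on [x_{j-1}, x_j], for 2 <= j *)
Definition interp2 (R : realType) (h : R) (phi : R -> R) (j : nat) (t : R) : R :=
  (t - node h j.-1) * (t - node h j) / (2 * h ^+ 2) * phi (node h j.-2)
  - (t - node h j.-2) * (t - node h j) / h ^+ 2 * phi (node h j.-1)
  + (t - node h j.-2) * (t - node h j.-1) / (2 * h ^+ 2) * phi (node h j).

(* int_{x_{j-1}}^{x_j} (x_k - t)^{-alpha} (phi - p)'(t) dt *)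
Definition caputo_piece (R : realType) (h alpha : R) (phi p : R -> R)
    (k j : nat) : R :=
  Rintegral lebesgue_measure `[node h j.-1, node h j]
    (fun t => (node h k - t) `^ (- alpha) *
      derive_within `[node h j.-1, node h j] (fun s => phi s - p s) t).

(* int_{x_{j-1}}^{x_j} K(x_k, t) (phi(t) - p(t)) dt *)
Definition kernel_piece (R : realType) (h : R) (K : R -> R -> R)
    (phi p : R -> R) (k j : nat) : R :=
  Rintegral lebesgue_measure `[node h j.-1, node h j]
    (fun t => K (node h k) t * (phi t - p t)).

(* G^k(phi, h, alpha); the free term f of the equation cancels in the error. *)
Definition scheme_error (R : realType) (h alpha : R) (K : R -> R -> R)
    (phi : R -> R) (k : nat) : R :=
  (Gamma (1 - alpha))^-1 *
    (caputo_piece h alpha phi (interp1 h phi) k 1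
     + \sum_(2 <= j < k.+1) caputo_piece h alpha phi (interp2 h phi j) k j)
  - kernel_piece h K phi (interp1 h phi) k 1
  - \sum_(2 <= j < k.+1) kernel_piece h K phi (interp2 h phi j) k j.

(* Main.v *)
Require Import Defs.
From HB Require Import structures.
From mathcomp Require Import all_boot all_order all_algebra.
From mathcomp Require Import all_classical all_reals all_analysis.
From mathcomp Require Import measurable_realfun.
From mathcomp Require Import ring lra.
Import Order.TTheory GRing.Theory Num.Theory.
Import numFieldNormedType.Exports.

Set Implicit Arguments.
Unset Strict Implicit.
Unset Printing Implicit Defensive.

Local Open Scope classical_set_scope.
Local Open Scope ring_scope.

(** On every subinterval the interpolation error e = phi - p vanishes at both
    end points, so integrating the Caputo term by parts leaves no boundary term:
    with w t = (c - t)^(-alpha),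

      int w e' = - alpha int (c - t)^(-alpha-1) e.

    This moves the derivative off e, and only pointwise bounds on e remain to be
    integrated against the kernel (c - t)^(-alpha-1).  These come from the
    Lagrange remainders, obtained by iterating Rolle's theorem
    ([linear_interpolation_bound], [quadratic_interpolation_bound]):
    |e| <= max|phi''| / 2 * (t - a)(b - t) for the linear interpolant and
    |e| <= max|phi'''| / 6 * |(t - x0)(t - x1)(t - x2)| for the quadratic one.

    Four kinds of subintervals give the four constants of the Caputo part.
    - On [x_0, x_1] with k = 1 and on [x_(k-1), x_k] the kernel is singular at
      the right end, where e vanishes to first order.  Expanding the bound on e
      in powers of c - t, each power is integrated in closed form
      ([caputo_piece_last]).  For k = 1 this gives
      alpha / (2 (1 - alpha)(2 - alpha)), which is turned into the quotient by
      Gamma (3 - alpha) by the functional equation of Gamma ([Gamma_succ]).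
    - On [x_0, x_1] with k >= 2 the kernel is at most its value at x_1, and
      int_0^h t (h - t) dt = h^3 / 6 ([caputo_piece_first]).
    - On [x_(j-1), x_j] with 2 <= j < k, |e| <= max|phi'''| / 12 * h^3, and the
      integrals of alpha (c - t)^(-alpha-1) telescope over j to a difference
      that is at most h^(-alpha) ([caputo_piece_mid], [caputo_sum_bound]).

    The kernel terms need only the uniform bounds on e.

    The integrals involved are improper at an end point, so the integration by
    parts rests on a fundamental theorem of calculus for functions continuous on
    an open interval, with a primitive continuous on the closed one: first for
    nonnegative integrands by monotone convergence ([ge0_FTC2_oo]), then for
    integrands dominated by such a one ([dominated_FTC2_oo]). *)

(** * Relative derivatives and differentiable functions on a segment *)

Lemma within_dnbhs_interior (R : realType) (A : set R) (x : R) :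
  A° x -> within A x^' = x^'.
Proof.
move=> Ax; apply/predeqP => U; rewrite /dnbhs /within /=; split.
  by apply: filterS2 Ax => y Ay + yx => /(_ yx); exact.
by apply: filterS => y + yx Ay; exact.
Qed.

Lemma dnbhs_shift (R : realType) (T : Type) (g : R -> T) (x : R) :
  g @ x^' = (g \o shift x) @ 0^'.
Proof.
apply/predeqP => U.
have -> : (g @ x^') U = \forall y \near x, y != x -> U (g y) by [].
have -> : ((g \o shift x) @ 0^') U =
  \forall y \near 0, y != 0 -> U (g (y + x)) by [].
rewrite (near_shift 0 x) subr0 /=.
have E (h : R) : (h + x != x) = (h != 0).
  by rewrite -[in RHS](addrK x h) subr_eq0.
by split; apply: filterS => h /=; rewrite E.
Qed.

Lemma slope_shift (R : realType) (f : R -> R) (x : R) :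
  slope f x \o shift x =
    (fun h : R => h^-1 *: ((f \o shift x) (h *: 1) - f x)).
Proof.
by apply/funext => h; rewrite /slope /= addrK mulrC /GRing.scale /= mulr1.
Qed.

(** The punctured neighbourhoods of an interior point do not see the set, so
    the relative derivative is the two-sided one there; this lemma and the next
    one transfer it in both directions. *)
Lemma is_derive_within (R : realType) (A : set R) (f : R -> R) (x : R) :
  A° x -> derivable_within A f x -> is_derive x 1 f (derive_within A f x).
Proof.
move=> Ax; rewrite /derivable_within /derive_within within_dnbhs_interior //.
by rewrite dnbhs_shift slope_shift => df; exact: DeriveDef.
Qed.

Lemma derive_within_interior (R : realType) (A : set R) (f : R -> R) (x d : R) :
  A° x -> is_derive x 1 f d -> derive_within A f x = d.
Proof.
move=> Ax fd; rewrite /derive_within within_dnbhs_interior // dnbhs_shift.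
by rewrite slope_shift -[RHS](@derive_val _ _ _ _ _ _ _ fd).
Qed.

Lemma interior_itvcc (R : realType) (a b x : R) :
  x \in `]a, b[ -> (`[a, b]%classic)° x.
Proof.
move=> /near_in_itvoo; apply: filterS => y /=.
exact: subset_itv_oo_cc.
Qed.

Lemma is_derive_continuous (R : realType) (f : R -> R) (x d : R) :
  is_derive x 1 f d -> {for x, continuous f}.
Proof.
by move=> fd; apply/differentiable_continuous/derivable1_diffP.
Qed.

(** The hypotheses of Rolle's theorem: continuity up to the end points and a
    two-sided derivative in the interior. *)
Definition has_deriv_on (R : realType) (a b : R) (f f' : R -> R) : Prop :=
  {within `[a, b], continuous f} /\
  forall x : R, x \in `]a, b[ -> is_derive x 1 f (f' x).

Lemma has_deriv_onS (R : realType) (a b c d : R) (f f' : R -> R) :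
  a <= c -> d <= b -> has_deriv_on a b f f' -> has_deriv_on c d f f'.
Proof.
move=> ac db [cf df]; split.
  by apply: continuous_subspaceW cf; apply: subset_itv; rewrite bnd_simp.
by move=> x xcd; apply: df; move: x xcd; apply: subset_itv; rewrite bnd_simp.
Qed.

Lemma has_deriv_onB (R : realType) (a b : R) (f f' p p' : R -> R) :
  has_deriv_on a b f f' -> (forall x : R, is_derive x 1 p (p' x)) ->
  has_deriv_on a b (fun x => f x - p x) (fun x => f' x - p' x).
Proof.
move=> [cf df] dp; split => x.
  apply: cvgB; first exact: cf.
  apply: continuous_subspaceT => {}x.
  exact: is_derive_continuous (dp x).
move=> xab; have := df x xab; have := dp x => dpx dfx.
exact: is_deriveB.
Qed.

Lemma class_C_has_deriv_on (R : realType) (m i : nat) (a b : R) (f : R -> R) :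
  class_C m `[a, b] f -> (i < m)%N ->
  has_deriv_on a b (derive_withinn `[a, b] i f) (derive_withinn `[a, b] i.+1 f).
Proof.
move=> [df cf] im; split; first exact/cf/ltnW.
move=> x xab; apply: is_derive_within; first exact: interior_itvcc.
by apply: df => //=; exact: subset_itv_oo_cc.
Qed.

Lemma within_continuous_bounded (R : realType) (a b : R) (f : R -> R) :
  a <= b -> {within `[a, b], continuous f} ->
  forall t, t \in `[a, b] -> `|f t| <= maxabs a b f.
Proof. by move=> ab cf; have [_] := maxabs_max ab cf. Qed.

(** * An improper fundamental theorem of calculus *)

Lemma continuous_measurable_oo (R : realType) (f : R -> R) (a b : R) :
  {in `]a, b[, continuous f} -> measurable_fun `]a, b[ f.
Proof.
move=> cf; apply: open_continuous_measurable_fun => // x.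
by rewrite inE; exact: cf.
Qed.

(** The segments [a + d n, b - d n] exhaust the open interval; the ordinary
    theorem applies on each, the integrals increase by nonnegativity of f, and
    the increments of F converge because F is continuous up to the ends. *)
Lemma ge0_FTC2_oo (R : realType) (f F : R -> R) (a b : R) : a < b ->
  {in `]a, b[, forall x, 0 <= f x} ->
  {in `]a, b[, continuous f} ->
  (forall x : R, x \in `]a, b[ -> is_derive x 1 F (f x)) ->
  {within `[a, b], continuous F} ->
  (\int[lebesgue_measure]_(x in `]a, b[) (f x)%:E = (F b - F a)%:E)%E.
Proof.
move=> ab f0 cf dF cF.
have [_ Fa Fb] := (continuous_within_itvP _ ab).1 cF.
(* n.+3 keeps d n below (b - a) / 2, so that the segments are nondegenerate. *)
pose d (n : nat) : R := (b - a) / n.+3%:R.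
have d0 n : 0 < d n by rewrite divr_gt0 ?subr_gt0.
have d2 n : d n < (b - a) / 2.
  by rewrite ltr_pM2l ?subr_gt0// ltf_pV2 ?posrE// ltr_nat.
have d_nincr m n : (m <= n)%N -> d n <= d m.
  by move=> mn; rewrite ler_pM2l ?subr_gt0// lef_pV2 ?posrE// ler_nat !ltnS.
have d_cvg : d @ \oo --> 0.
  rewrite -[X in _ --> X](mulr0 (b - a)); apply: cvgMr.
  have := @cvg_harmonic R; rewrite -(cvg_shiftn 2); apply: cvg_trans.
  by apply: near_eq_cvg; apply: nearW => n; rewrite /harmonic /= addn2.
pose I n : set R := `[a + d n, b - d n]%classic.
have I_oo n x : I n x -> x \in `]a, b[.
  rewrite /I /= !in_itv /= => /andP[ax xb]; apply/andP; split.
    by rewrite (lt_le_trans _ ax)// ltrDl.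
  by rewrite (le_lt_trans xb)// gtrBl.
have I_bigcup : \bigcup_n I n = `]a, b[%classic.
  apply/seteqP; split => [x [n _ /I_oo //]|x].
  rewrite /= in_itv /= => /andP[ax xb].
  have : \forall n \near \oo, d n < Num.min (x - a) (b - x).
    by apply: (cvgr_lt 0) => //; rewrite lt_min !subr_gt0 ax xb.
  case=> n _ /(_ n (leqnn n)) /=; rewrite lt_min => /andP[dx xd].
  exists n => //; rewrite /I /= in_itv /=; apply/andP; split; lra.
have mf := continuous_measurable_oo cf.
rewrite -I_bigcup.
have int_cvg : (\int[lebesgue_measure]_(x in I n) (f x)%:E @[n --> \oo] -->
    \int[lebesgue_measure]_(x in \bigcup_n I n) (f x)%:E)%E.
  apply: ge0_nondecreasing_set_cvg_integral => [m n mn|n|n|n x /I_oo xab].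
  - apply/subsetPset; apply: subset_itv; rewrite bnd_simp.
      by rewrite lerD2l d_nincr.
    by rewrite lerB// d_nincr.
  - exact: measurable_itv.
  - apply/measurable_EFinP; apply: measurable_funS mf => //.
    by move=> x /I_oo.
  - by rewrite lee_fin f0.
apply: (cvg_unique _ int_cvg) => //.
have -> : (fun n => \int[lebesgue_measure]_(x in I n) (f x)%:E)%E =
    (fun n => (F (b - d n) - F (a + d n))%:E).
  apply/funext => n; rewrite EFinB /I.
  have adbd : a + d n < b - d n by have := d2 n; lra.
  apply: continuous_FTC2 => //.
  - apply: continuous_in_subspaceT => x; rewrite inE => /I_oo; exact: cf.
  - have dFI x : x \in `[a + d n, b - d n] -> derivable F x 1.
      by move=> /(I_oo n) /dF.
    have cFI x : x \in `[a + d n, b - d n] -> {for x, continuous F}.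
      by move=> /dFI/derivable1_diffP/differentiable_continuous.
    split.
    + by move=> x xI; apply: dFI; exact: subset_itv_oo_cc xI.
    + by apply: cvg_at_right_filter; apply: cFI; rewrite in_itv /= lexx ltW.
    + by apply: cvg_at_left_filter; apply: cFI; rewrite in_itv /= lexx ltW.
  - move=> x xI; have := @subset_itv_oo_cc _ _ _ _ _ xI.
    by move=> /(I_oo n) /dF dFx; rewrite derive1E derive_val.
apply: cvg_EFin; first exact: nearW.
have ad : (fun n => a + d n) @ \oo --> a.
  by rewrite -[X in _ --> X]addr0; apply: cvgD => //; exact: cvg_cst.
have bd : (fun n => b - d n) @ \oo --> b.
  by rewrite -[X in _ --> X]subr0; apply: cvgB => //; exact: cvg_cst.
apply: cvgB.
- by apply: (cvg_at_leftP _ _ _).1 Fb _ _; split => // n; rewrite gtrBl.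
- by apply: (cvg_at_rightP _ _ _).1 Fa _ _; split => // n; rewrite ltrDl.
Qed.

(** Domination by a function with a primitive continuous up to the ends is how
    integrability of all singular integrands is obtained below. *)
Lemma dominated_integrable_oo (R : realType) (f g G : R -> R) (a b : R) : a < b ->
  {in `]a, b[, forall x, `|f x| <= g x} ->
  {in `]a, b[, continuous f} -> {in `]a, b[, continuous g} ->
  (forall x : R, x \in `]a, b[ -> is_derive x 1 G (g x)) ->
  {within `[a, b], continuous G} ->
  lebesgue_measure.-integrable `]a, b[ (EFin \o f).
Proof.
move=> ab fg cf cg dG cG.
have g0 : {in `]a, b[, forall x, 0 <= g x} by move=> x /fg; apply: le_trans.
have ig : lebesgue_measure.-integrable `]a, b[ (EFin \o g).
  apply/integrableP; split.
    by apply/measurable_EFinP; apply: continuous_measurable_oo.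
  have -> : (\int[lebesgue_measure]_(x in `]a, b[) `|(EFin \o g) x| =
             \int[lebesgue_measure]_(x in `]a, b[) (g x)%:E)%E.
    by apply: eq_integral => x; rewrite inE => xab; rewrite /= ger0_norm // g0.
  by rewrite (ge0_FTC2_oo ab g0 cg dG cG) ltry.
apply: le_integrable ig => //.
  by apply/measurable_EFinP; apply: continuous_measurable_oo.
by move=> x /= xab; rewrite lee_fin (le_trans (fg _ xab)) // ler_norm.
Qed.

(** The sign condition of the nonnegative case is removed by applying it to
    f + g and to g, and subtracting. *)
Lemma dominated_FTC2_oo (R : realType) (f g F G : R -> R) (a b : R) : a < b ->
  {in `]a, b[, forall x, `|f x| <= g x} ->
  {in `]a, b[, continuous f} -> {in `]a, b[, continuous g} ->
  (forall x : R, x \in `]a, b[ -> is_derive x 1 F (f x)) ->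
  (forall x : R, x \in `]a, b[ -> is_derive x 1 G (g x)) ->
  {within `[a, b], continuous F} -> {within `[a, b], continuous G} ->
  (\int[lebesgue_measure]_(x in `]a, b[) f x)%R = F b - F a.
Proof.
move=> ab fg cf cg dF dG cF cG.
have g0 : {in `]a, b[, forall x, 0 <= g x} by move=> x /fg; apply: le_trans.
have gg : {in `]a, b[, forall x, `|g x| <= g x}.
  by move=> x /g0 ?; rewrite ger0_norm.
have intf := dominated_integrable_oo ab fg cf cg dG cG.
have intg := dominated_integrable_oo ab gg cg cg dG cG.
have fg0 : {in `]a, b[, forall x, 0 <= f x + g x}.
  by move=> x /fg; rewrite ler_norml -subr_ge0 opprK addrC => /andP[].
have intfg : (\int[lebesgue_measure]_(x in `]a, b[) (f x + g x)%:E =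
    (F b + G b - (F a + G a))%:E)%E.
  apply: (@ge0_FTC2_oo _ (fun x => f x + g x) (fun x => F x + G x)) => //.
  - by move=> x xab; apply: continuousD; [exact: cf|exact: cg].
  - by move=> x xab; have := dF x xab; have := dG x xab => *; exact: is_deriveD.
  - by move=> x; apply: continuousD; [exact: cF|exact: cG].
have := RintegralD _ intf intg => /(_ (measurable_itv _)).
rewrite /Rintegral intfg (ge0_FTC2_oo ab g0 cg dG cG) /= => E.
by apply: (addIr (G b - G a)); rewrite -E; ring.
Qed.

(** End points are negligible, so an integrand given by one-sided derivatives
    there may be replaced by one known only in the interior. *)
Lemma Rintegral_itvcc_oo (R : realType) (f g : R -> R) (a b : R) :
  {in `]a, b[, f =1 g} -> {in `]a, b[, continuous g} ->
  (\int[lebesgue_measure]_(x in `[a, b]) f x =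
   \int[lebesgue_measure]_(x in `]a, b[) g x)%R.
Proof.
move=> fg cg; rewrite /Rintegral integral_itv_bndoo.
  by congr fine; apply: eq_integral => x; rewrite inE => /fg ->.
apply/measurable_EFinP; apply: eq_measurable_fun (continuous_measurable_oo cg).
by move=> x; rewrite inE => /fg ->.
Qed.

(** * Integration by parts against a power singularity *)

Lemma eq_ler (R : realType) (x y : R) : x = y -> x <= y.
Proof. by move=> ->. Qed.

Lemma ge0_ler_powRN (R : realType) (u v q : R) : 0 < u -> u <= v -> q <= 0 ->
  v `^ q <= u `^ q.
Proof.
move=> u0 uv q0; rewrite -[q]opprK !(powRN _ (- q)) lef_pV2 ?posrE ?powR_gt0 //.
  by apply: ge0_ler_powR; rewrite ?nnegrE ?oppr_ge0 // ltW // (lt_le_trans u0).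
exact: lt_le_trans uv.
Qed.

Lemma powRD1 (R : realType) (u q : R) : 0 < u -> u `^ (q + 1) = u `^ q * u.
Proof.
move=> u0; rewrite powRD; first by rewrite powRr1 // ltW.
by apply/implyP => _; rewrite gt_eqF.
Qed.

Lemma is_derive_powR_subl (R : realType) (c p t : R) : t < c ->
  is_derive t 1 (fun x => (c - x) `^ p) (- (p * (c - t) `^ (p - 1))).
Proof.
move=> tc; have ct : 0 < c - t by rewrite subr_gt0.
have dsub : is_derive t 1 (fun x => c - x) (-1).
  by apply: is_derive_eq; ring.
have := @is_derive1_comp R (fun x => x `^ p) (fun x => c - x) _ _ _
  (is_derive1_powR p ct) dsub.
by rewrite mulrN1.
Qed.

Lemma continuous_powR_subl (R : realType) (c p t : R) : t < c ->
  {for t, continuous (fun x => (c - x) `^ p)}.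
Proof. by move=> /(is_derive_powR_subl p) /is_derive_continuous. Qed.

Lemma cvg_powR_subl_at_left (R : realType) (b p : R) : 0 < p ->
  (b - t) `^ p @[t --> b^'-] --> 0.
Proof.
move=> p0; apply/cvg_at_leftP => u [ub ucvg].
have /cvg_at_rightP := powR_cvg0 p0; apply.
split; first by move=> n; rewrite subr_gt0.
by rewrite -[X in _ --> X](subrr b); apply: cvgB => //; exact: cvg_cst.
Qed.

Lemma within_continuous_powR_subl (R : realType) (a b c p : R) :
  a < b -> b <= c -> 0 < p -> {within `[a, b], continuous (fun t => (c - t) `^ p)}.
Proof.
move=> ab bc p0; apply/(continuous_within_itvP _ ab); split.
- move=> t; rewrite in_itv /= => /andP[_ tb].
  by apply: continuous_powR_subl; rewrite (lt_le_trans tb).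
- by apply/cvg_at_right_filter/continuous_powR_subl; rewrite (lt_le_trans ab).
- move: bc; rewrite le_eqVlt => /predU1P[<-|bc].
    by rewrite subrr powR0 ?gt_eqF//; exact: cvg_powR_subl_at_left.
  by apply/cvg_at_left_filter/continuous_powR_subl.
Qed.

(** This linear decay of e at b is what compensates the singularity of the
    weight when b is the point where the weight blows up. *)
Lemma norm_le_of_zero_right (R : realType) (C a b : R) (e de : R -> R) :
  {within `[a, b], continuous e} ->
  (forall t : R, t \in `]a, b[ -> is_derive t 1 e (de t)) ->
  (forall t, t \in `]a, b[ -> `|de t| <= C) -> e b = 0 ->
  forall t, t \in `]a, b[ -> `|e t| <= C * (b - t).
Proof.
move=> ce ede deC eb0 t; rewrite in_itv /= => /andP[a_t tb].
have sub_ab x : x \in `]t, b[ -> x \in `]a, b[.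
  by apply: subset_itvr; rewrite bnd_simp ltW.
have ctb : {within `[t, b], continuous e}.
  by apply: continuous_subspaceW ce; apply: subset_itvr; rewrite bnd_simp ltW.
have [x /sub_ab xab E] := MVT tb (fun x xtb => ede x (sub_ab x xtb)) ctb.
rewrite -normrN -[- _]add0r -eb0 E normrM (gtr0_norm (x := b - t)) ?subr_gt0//.
by rewrite ler_wpM2r ?deC// subr_ge0 ltW.
Qed.

(** With w t = (c - t)^(-alpha), the product F = w e has derivative
    w e' + alpha (c - t)^(-alpha-1) e and vanishes at both ends: at b because e
    vanishes there and, when b = c, because |e| <= C (b - t) makes F of order
    (b - t)^(1 - alpha).  So F' has integral zero, and w e' lies between F' - g
    and F' + g.  The function C w + g, which has an explicit primitive,
    dominates F' and provides integrability. *)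
Lemma weighted_integral_bound (R : realType) (alpha C a b c : R)
    (e de g G : R -> R) :
  0 < alpha -> alpha < 1 -> a < b -> b <= c ->
  {within `[a, b], continuous e} ->
  (forall t : R, t \in `]a, b[ -> is_derive t 1 e (de t)) ->
  {in `]a, b[, continuous de} ->
  (forall t, t \in `]a, b[ -> `|de t| <= C) ->
  e a = 0 -> e b = 0 ->
  (forall t, t \in `]a, b[ -> alpha * (c - t) `^ (- alpha - 1) * `|e t| <= g t) ->
  {in `]a, b[, continuous g} ->
  (forall t : R, t \in `]a, b[ -> is_derive t 1 G (g t)) ->
  {within `[a, b], continuous G} ->
  `|\int[lebesgue_measure]_(t in `]a, b[) ((c - t) `^ (- alpha) * de t)|%R
    <= G b - G a.
Proof.
move=> alpha0 alpha1 ab bc ce ede cde deC ea0 eb0 eg cg dG cG.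
have tc t : t \in `]a, b[ -> t < c.
  by rewrite in_itv /= => /andP[_ tb]; rewrite (lt_le_trans tb).
pose w t := (c - t) `^ (- alpha).
have dw t : t \in `]a, b[ ->
    is_derive t 1 w (alpha * (c - t) `^ (- alpha - 1)).
  by move=> /tc /(is_derive_powR_subl (- alpha)); rewrite mulNr opprK.
have cw t : t \in `]a, b[ -> {for t, continuous w}.
  by move=> /dw /is_derive_continuous.
have ct t : t \in `]a, b[ -> {for t, continuous e}.
  by move=> /ede /is_derive_continuous.
pose dF t := w t * de t + alpha * (c - t) `^ (- alpha - 1) * e t.
pose F t := w t * e t.
have dFE t : t \in `]a, b[ -> is_derive t 1 F (dF t).
  move=> tab; have dwt := dw t tab; have det := ede t tab.
  apply: is_derive_eq; rewrite /dF /GRing.scale /= addrC; ring.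
(* C w has the primitive - C / (1 - alpha) * (c - t)^(1 - alpha). *)
pose dom t := C * w t + g t.
pose Dom t := - (C / (1 - alpha)) * (c - t) `^ (1 - alpha) + G t.
have alpha1' : 0 < 1 - alpha by rewrite subr_gt0.
have cwde : {in `]a, b[, continuous (fun t => w t * de t)}.
  by move=> t tab; apply: cvgM; [exact: cw|exact: cde].
have cwe : {in `]a, b[, continuous
    (fun t => alpha * (c - t) `^ (- alpha - 1) * e t)}.
  move=> t tab; apply: cvgM; last exact: ct.
  by apply: cvgM; [exact: cvg_cst|exact/continuous_powR_subl/tc].
have cdF : {in `]a, b[, continuous dF}.
  by move=> t tab; apply: cvgD; [exact: cwde|exact: cwe].
have cdom : {in `]a, b[, continuous dom}.
  move=> t tab; apply: cvgD; last exact: cg.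
  by apply: cvgM; [exact: cvg_cst|exact: cw].
have dDom t : t \in `]a, b[ -> is_derive t 1 Dom (dom t).
  move=> tab; have dGt := dG t tab.
  have dpt := is_derive_powR_subl (1 - alpha) (tc t tab).
  apply: is_derive_eq; rewrite /dom /w /GRing.scale /=.
  have -> : 1 - alpha - 1 = - alpha by ring.
  by field; rewrite gt_eqF.
have cDom : {within `[a, b], continuous Dom}.
  move=> t; apply: cvgD; last exact: cG.
  apply: cvgM; first exact: cvg_cst.
  exact: within_continuous_powR_subl.
have lip := norm_le_of_zero_right ce ede deC eb0.
have cF : {within `[a, b], continuous F}.
  apply/(continuous_within_itvP _ ab).
  have [_ ea _] := (continuous_within_itvP _ ab).1 ce.
  split => [t tab||].
  - exact: is_derive_continuous (dFE t tab).
  - apply: cvgM => //; apply/cvg_at_right_filter/continuous_powR_subl.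
    exact: lt_le_trans bc.
  (* |F t| <= C (b - t) (c - t)^(-alpha) <= C (b - t)^(1 - alpha). *)
  - rewrite /F eb0 mulr0; apply/norm_cvg0P.
    apply: (@squeeze_cvgr _ _ _ _ (fun=> 0)
      (fun t => C * (b - t) `^ (1 - alpha))); last 2 first.
    + exact: cvg_cst.
    + rewrite -[X in _ --> X](mulr0 C); apply: cvgMr.
      exact: cvg_powR_subl_at_left.
    near=> t; have tab : t \in `]a, b[.
      by rewrite in_itv /=; apply/andP; split.
    have tb : 0 < b - t by move: tab; rewrite in_itv /= subr_gt0 => /andP[].
    rewrite normr_ge0 /= normrM ger0_norm ?powR_ge0//.
    rewrite (le_trans (ler_wpM2l (powR_ge0 _ _) (lip t tab)))//.
    rewrite mulrCA ler_wpM2l//.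
      exact: le_trans (deC t tab).
    rewrite [1 - alpha]addrC powRD1 // ler_wpM2r ?(ltW tb)//.
    by rewrite ge0_ler_powRN // ?lerB // oppr_le0 ltW.
have abs_wde t : t \in `]a, b[ -> `|w t * de t| <= C * w t.
  move=> tab; rewrite normrM ger0_norm ?powR_ge0// mulrC.
  by rewrite ler_wpM2r ?deC// powR_ge0.
have abs_we t : t \in `]a, b[ -> `|alpha * (c - t) `^ (- alpha - 1) * e t| <= g t.
  move=> tab; rewrite normrM ger0_norm; first exact: eg.
  by rewrite mulr_ge0 ?powR_ge0// ltW.
have g0 t : t \in `]a, b[ -> 0 <= g t.
  by move=> /abs_we; apply: le_trans.
have abs_dF t : t \in `]a, b[ -> `|dF t| <= dom t.
  by move=> tab; rewrite (le_trans (ler_normD _ _))// lerD ?abs_wde ?abs_we.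
have abs_g t : t \in `]a, b[ -> `|g t| <= g t.
  by move=> /g0 ?; rewrite ger0_norm.
have abs_wde' t : t \in `]a, b[ -> `|w t * de t| <= dom t.
  by move=> tab; rewrite (le_trans (abs_wde t tab))// lerDl g0.
have int_wde := dominated_integrable_oo ab abs_wde' cwde cdom dDom cDom.
have int_dF := dominated_integrable_oo ab abs_dF cdF cdom dDom cDom.
have int_g := dominated_integrable_oo ab abs_g cg cg dG cG.
have dFI := dominated_FTC2_oo ab abs_dF cdF cdom dFE dDom cF cDom.
have gI := dominated_FTC2_oo ab abs_g cg cg dG dG cG cG.
rewrite /F ea0 eb0 !mulr0 subrr in dFI.
have le_we t : t \in `]a, b[ ->
    - g t <= alpha * (c - t) `^ (- alpha - 1) * e t <= g t.
  by move=> /abs_we; rewrite ler_norml.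
rewrite ler_norml -gI; apply/andP; split.
- rewrite -[leLHS]add0r -dFI -RintegralB //.
  apply: le_Rintegral => //; first exact: (integrableB _ int_dF int_g).
  by move=> t /le_we /andP[_]; rewrite /dF /w; lra.
- rewrite -[leRHS]add0r -dFI -RintegralD //.
  apply: le_Rintegral => //; first exact: (integrableD _ int_dF int_g).
  by move=> t /le_we /andP[+ _]; rewrite /dF /w; lra.
Unshelve. all: by end_near. Qed.

(** * Remainders of linear and quadratic interpolation *)

Lemma rolle2 (R : realType) (a b x y : R) (f f1 : R -> R) :
  has_deriv_on a b f f1 -> a <= x -> x < y -> y <= b -> f x = 0 -> f y = 0 ->
  exists2 c, x < c < y & f1 c = 0.
Proof.
move=> df ax xy yb fx fy; have [cf {}df] := has_deriv_onS ax yb df.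
have [||c xcy dfc] := Rolle xy _ cf; last 1 first.
- exists c; first by rewrite in_itv in xcy.
  rewrite -(@derive_val _ _ _ _ _ _ _ (df c xcy)).
  exact: (@derive_val _ _ _ _ _ _ _ dfc).
- by move=> t /df ?.
- by rewrite fx fy.
Qed.

Lemma rolle3 (R : realType) (a b x y z : R) (f f1 f2 : R -> R) :
  has_deriv_on a b f f1 -> has_deriv_on a b f1 f2 ->
  a <= x -> x < y -> y < z -> z <= b -> f x = 0 -> f y = 0 -> f z = 0 ->
  exists2 c, x < c < z & f2 c = 0.
Proof.
move=> df df1 ax xy yz zb fx fy fz.
have [|c /andP[xc cy] f1c] := rolle2 df ax xy _ fx fy; first lra.
have [|d /andP[yd dz] f1d] := rolle2 df _ yz zb fy fz; first lra.
have [|||u /andP[cu ud] f2u] := rolle2 df1 (x := c) (y := d) _ _ _ f1c f1d;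
  [lra..|].
by exists u => //; apply/andP; split; lra.
Qed.

Lemma rolle4 (R : realType) (a b x y z t : R) (f f1 f2 f3 : R -> R) :
  has_deriv_on a b f f1 -> has_deriv_on a b f1 f2 -> has_deriv_on a b f2 f3 ->
  a <= x -> x < y -> y < z -> z < t -> t <= b ->
  f x = 0 -> f y = 0 -> f z = 0 -> f t = 0 ->
  exists2 c, x < c < t & f3 c = 0.
Proof.
move=> df df1 df2 ax xy yz zt tb fx fy fz ft.
have [|c /andP[xc cy] f1c] := rolle2 df ax xy _ fx fy; first lra.
have [||d /andP[yd dz] f1d] := rolle2 df _ yz _ fy fz; [lra..|].
have [|u /andP[zu ut] f1u] := rolle2 df _ zt tb fz ft; first lra.
have [||||v /andP[cv vu] f3v] :=
  rolle3 df1 df2 (x := c) (y := d) (z := u) _ _ _ _ f1c f1d f1u; [lra..|].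
by exists v => //; apply/andP; split; lra.
Qed.

Lemma is_derive_cubic (R : realType) (q0 q1 q2 q3 x : R) :
  is_derive x 1 (fun s => q0 + q1 * s + q2 * s ^+ 2 + q3 * s ^+ 3)
    (q1 + 2 * q2 * x + 3 * q3 * x ^+ 2).
Proof. by apply: is_derive_eq; rewrite /GRing.scale /=; ring. Qed.

(** Subtract from f the interpolant plus l (s - a)(s - b), with l chosen so
    that the difference also vanishes at t: three zeros force f'' = 2 l
    somewhere. *)
Lemma linear_interpolation_bound (R : realType) (a b M A B : R)
    (f f1 f2 : R -> R) :
  has_deriv_on a b f f1 -> has_deriv_on a b f1 f2 ->
  (forall t, t \in `]a, b[ -> `|f2 t| <= M) ->
  f a = A + B * a -> f b = A + B * b ->
  forall t, t \in `]a, b[ -> `|f t - (A + B * t)| <= M / 2 * ((t - a) * (b - t)).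
Proof.
move=> df df1 f2M fa fb t; rewrite in_itv /= => /andP[a_t tb].
pose l := (f t - (A + B * t)) / ((t - a) * (t - b)).
have ta0 : t - a != 0 by rewrite subr_eq0 gt_eqF.
have tb0 : t - b != 0 by rewrite subr_eq0 lt_eqF.
have lE : f t - (A + B * t) = l * ((t - a) * (t - b)).
  by rewrite /l divfK // mulf_neq0.
clearbody l.
pose q s := (A + l * (a * b)) + (B - l * (a + b)) * s + l * s ^+ 2 + 0 * s ^+ 3.
have qE s : q s = A + B * s + l * ((s - a) * (s - b)) by rewrite /q; ring.
have dq := is_derive_cubic (A + l * (a * b)) (B - l * (a + b)) l 0.
have dq1 (x : R) : is_derive x 1
    (fun s => (B - l * (a + b)) + 2 * l * s + 3 * 0 * s ^+ 2) (2 * l).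
  by apply: is_derive_eq; rewrite /GRing.scale /=; ring.
have g1 := has_deriv_onB df dq; have g2 := has_deriv_onB df1 dq1.
have [| | |c /andP[ac cb] /eqP] := rolle3 g1 g2 (lexx a) a_t tb (lexx b).
- by rewrite -/(q a) qE fa; ring.
- by rewrite -/(q t) qE -lE; ring.
- by rewrite -/(q b) qE fb; ring.
rewrite subr_eq0 => /eqP f2c.
rewrite lE !normrM (gtr0_norm (x := t - a)) ?subr_gt0//.
rewrite (ltr0_norm (x := t - b)) ?subr_lt0//.
rewrite opprB ler_wpM2r //; first by rewrite mulr_ge0 ?subr_ge0 ?ltW.
have := f2M c; rewrite in_itv /= ac cb f2c normrM => /(_ isT).
by rewrite (@ger0_norm _ 2)//; lra.
Qed.

(** As in the linear case with l (s - x0)(s - x1)(s - x2): four zeros force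
    f''' = 6 l somewhere.  Only t beyond x1 is considered, since the interpolant
    serves on the last of its two subintervals. *)
Lemma quadratic_interpolation_bound (R : realType) (x0 x1 x2 M A B C : R)
    (f f1 f2 f3 : R -> R) :
  x0 < x1 ->
  has_deriv_on x0 x2 f f1 -> has_deriv_on x0 x2 f1 f2 ->
  has_deriv_on x0 x2 f2 f3 ->
  (forall t, t \in `]x0, x2[ -> `|f3 t| <= M) ->
  let p s := A + B * s + C * s ^+ 2 in
  f x0 = p x0 -> f x1 = p x1 -> f x2 = p x2 ->
  forall t, t \in `]x1, x2[ ->
    `|f t - p t| <= M / 6 * ((t - x0) * (t - x1) * (x2 - t)).
Proof.
move=> x01 df df1 df2 f3M p fx0 fx1 fx2 t; rewrite in_itv /= => /andP[x1t tx2].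
pose l := (f t - p t) / ((t - x0) * (t - x1) * (t - x2)).
have t0 : t - x0 != 0 by rewrite subr_eq0 gt_eqF// (lt_trans x01).
have t1 : t - x1 != 0 by rewrite subr_eq0 gt_eqF.
have t2 : t - x2 != 0 by rewrite subr_eq0 lt_eqF.
have lE : f t - p t = l * ((t - x0) * (t - x1) * (t - x2)).
  by rewrite /l divfK // !mulf_neq0.
clearbody l.
pose q0 := A - l * (x0 * x1 * x2).
pose q1 := B + l * (x0 * x1 + x0 * x2 + x1 * x2).
pose q2 := C - l * (x0 + x1 + x2).
pose q s := q0 + q1 * s + q2 * s ^+ 2 + l * s ^+ 3.
have qE s : q s = p s + l * ((s - x0) * (s - x1) * (s - x2)).
  by rewrite /q /p /q0 /q1 /q2; ring.
have dq := is_derive_cubic q0 q1 q2 l.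
have dq1 (x : R) : is_derive x 1
    (fun s => q1 + 2 * q2 * s + 3 * l * s ^+ 2) (2 * q2 + 6 * l * x).
  by apply: is_derive_eq; rewrite /GRing.scale /=; ring.
have dq2 (x : R) : is_derive x 1 (fun s => 2 * q2 + 6 * l * s) (6 * l).
  by apply: is_derive_eq; rewrite /GRing.scale /=; ring.
have g1 := has_deriv_onB df dq; have g2 := has_deriv_onB df1 dq1.
have g3 := has_deriv_onB df2 dq2.
have [| | | |c /andP[ac cb] /eqP] :=
  rolle4 g1 g2 g3 (lexx x0) x01 x1t tx2 (lexx x2).
- by rewrite -/(q x0) qE fx0; ring.
- by rewrite -/(q x1) qE fx1; ring.
- by rewrite -/(q t) qE -lE; ring.
- by rewrite -/(q x2) qE fx2; ring.
rewrite subr_eq0 => /eqP f3c.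
have x0t := lt_trans x01 x1t.
rewrite lE !normrM (gtr0_norm (x := t - x0)) ?subr_gt0//.
rewrite (gtr0_norm (x := t - x1)) ?subr_gt0// (ltr0_norm (x := t - x2)) ?subr_lt0//.
rewrite opprB ler_wpM2r //; first by rewrite !mulr_ge0 ?subr_ge0 ?ltW.
have := f3M c; rewrite in_itv /= ac cb f3c normrM => /(_ isT).
by rewrite (@ger0_norm _ 6)//; lra.
Qed.

(** * The functional equation of the Gamma function *)

Lemma Gamma_ge0 (R : realType) (s : R) : 0 <= Gamma s.
Proof.
by apply: Rintegral_ge0 => t _; rewrite mulr_ge0 ?powR_ge0 ?expR_ge0.
Qed.

(** From 1 + y <= exp y at y = t / p with p = s + 1, raised to the power p:
    t^p <= p^p exp t, hence t^s exp (- t) <= p^p / t. *)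
Lemma gamma_kernel_cvg0 (R : realType) (s : R) : 0 <= s ->
  t `^ s * expR (- t) @[t --> +oo] --> 0.
Proof.
move=> s0; pose p := s + 1; have p0 : 0 < p by rewrite /p; lra.
have pn0 : p != 0 by rewrite gt_eqF.
apply: (@squeeze_cvgr _ _ _ _ (fun=> 0) (fun t => p `^ p * t^-1)).
- near=> t; have t0 : 0 < t by near: t; exact: nbhs_pinfty_gt.
  rewrite mulr_ge0 ?powR_ge0 ?expR_ge0 //= -ler_pdivrMr ?invr_gt0// invrK.
  have -> : t `^ s * expR (- t) * t = t `^ p * expR (- t).
    by rewrite /p powRD1 //; ring.
  rewrite expRN ler_pdivrMr ?expR_gt0//.
  rewrite -{1}(divfK pn0 t) powRM ?divr_ge0 ?(ltW t0) ?(ltW p0)// [leLHS]mulrC.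
  rewrite ler_wpM2l ?powR_ge0//.
  rewrite -[X in _ <= expR X](divfK pn0 t) expRM.
  have tp0 : 0 <= t / p by rewrite divr_ge0 ?(ltW t0) ?(ltW p0).
  apply: ge0_ler_powR; rewrite ?nnegrE ?expR_ge0 ?(ltW p0)//.
  by rewrite (le_trans _ (expR_ge1Dx _))// lerDr.
- exact: cvg_cst.
- rewrite -[X in _ --> X](mulr0 (p `^ p)); apply: cvgMr.
  by apply/gtr0_cvgV0; [exact: nbhs_pinfty_gt|exact: cvg_id].
Unshelve. all: by end_near. Qed.

(** Integration by parts amounts to F' = (s - t) u with u = t^(s-1) exp (- t) and
    F = t^s exp (- t).  The sign of F' changes at t = s only, so cutting the
    half-line there leaves two integrals of nonnegative functions, both equal to
    F s.  Nonnegative integrals may be added without knowing that they are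
    finite, which spares a proof that u is integrable. *)
Lemma Gamma_succ (R : realType) (s : R) : 0 < s -> Gamma (s + 1) = s * Gamma s.
Proof.
move=> s0; pose u (t : R) := t `^ (s - 1) * expR (- t).
pose F (t : R) := t `^ s * expR (- t).
have tu (t : R) : 0 < t -> F t = t * u t.
  by move=> t0; rewrite /F /u mulrA mulr_powRB1 ?(ltW t0).
have u0 (t : R) : 0 <= u t by rewrite mulr_ge0 ?powR_ge0 ?expR_ge0.
have dpow (q t : R) : 0 < t -> is_derive t 1 (fun x : R => x `^ q * expR (- x))
    ((q * t `^ (q - 1) - t `^ q) * expR (- t)).
  move=> t0; have dp := is_derive1_powR q t0.
  have dexp : is_derive t 1 (fun x : R => expR (- x)) (- expR (- t)).
    have := @is_derive1_comp R expR (fun x => - x) t (expR (- t)) (-1) _ _.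
    by rewrite mulrN1; apply.
  by apply: is_derive_eq; rewrite /GRing.scale /=; ring.
have dF (t : R) : 0 < t -> is_derive t 1 F ((s - t) * u t).
  move=> t0; have := dpow s t t0; congr is_derive.
  by rewrite !mulrBl -tu // /u /F mulrA.
have cu (t : R) : 0 < t -> {for t, continuous u}.
  by move=> /(dpow (s - 1)) /is_derive_continuous.
have cFt (t : R) : 0 < t -> {for t, continuous F}.
  by move=> /dF /is_derive_continuous.
have F0 : F 0 = 0 by rewrite /F powR0 ?mul0r // gt_eqF.
have cF : {within `[0, s], continuous F}.
  apply/(continuous_within_itvP _ s0); split.
  - by move=> t; rewrite in_itv /= => /andP[t0 _]; exact: cFt.
  - rewrite F0 -[X in _ --> X](mul0r (expR (- 0))); apply: cvgM.
      exact: powR_cvg0.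
    apply: cvg_at_right_filter; apply: continuous_comp.
      exact: opp_continuous.
    exact: continuous_expR.
  - exact/cvg_at_left_filter/cFt.
have int1 : (\int[lebesgue_measure]_(t in `]0%R, s[) ((s - t) * u t)%:E =
    (F s)%:E)%E.
  rewrite -[in RHS](subr0 (F s)) -[in RHS]F0.
  apply: (@ge0_FTC2_oo _ (fun t => (s - t) * u t)) => //.
  - move=> t; rewrite in_itv /= => /andP[t0 ts].
    by rewrite mulr_ge0 // subr_ge0 ltW.
  - move=> t; rewrite in_itv /= => /andP[t0 ts].
    apply: cvgM; last exact: cu.
    by apply: cvgB; [exact: cvg_cst|exact: cvg_id].
  - by move=> t; rewrite in_itv /= => /andP[t0 ts]; exact: dF.
have int2 : (\int[lebesgue_measure]_(t in `[s, +oo[) ((t - s) * u t)%:E =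
    (F s)%:E)%E.
  have dNF (t : R) : 0 < t -> is_derive t 1 (fun x => - F x) ((t - s) * u t).
    by move=> /dF dFt; apply: is_derive_eq; ring.
  rewrite (@ge0_continuous_FTC2y _ (fun t => (t - s) * u t) (fun t => - F t) s 0).
  - by rewrite -EFinB sub0r opprK.
  - by move=> t st; rewrite mulr_ge0 // subr_ge0.
  - apply: continuous_in_subspaceT => t; rewrite inE /= in_itv /= andbT => st.
    apply: cvgM; last by apply: cu; exact: lt_le_trans st.
    by apply: cvgB; [exact: cvg_id|exact: cvg_cst].
  - rewrite -[X in _ --> X]oppr0; apply: cvgN.
    by apply: gamma_kernel_cvg0; rewrite ltW.
  - by move=> t st; have := dNF t (lt_trans s0 st).
  - by apply: cvgN; exact/cvg_at_right_filter/cFt.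
  - move=> t; rewrite in_itv /= andbT => st; rewrite derive1E.
    by rewrite (@derive_val _ _ _ _ _ _ _ (dNF t (lt_trans s0 st))).
pose D0 : set R := `](0 : R), +oo[%classic.
pose D1 : set R := `](0 : R), s[%classic.
pose D2 : set R := `[s, +oo[%classic.
pose I (D : set R) (v : R -> R) := (\int[lebesgue_measure]_(t in D) (v t)%:E)%E.
have mD1 : measurable D1 by exact: measurable_itv.
have mD2 : measurable D2 by exact: measurable_itv.
have mI (v : R -> R) : (forall t : R, 0 < t -> {for t, continuous v}) ->
    measurable_fun `](0 : R), +oo[ v.
  move=> cv; apply: open_continuous_measurable_fun => // t.
  by rewrite inE /= in_itv /= andbT; exact: cv.
have split_int (v : R -> R) : (forall t : R, 0 < t -> {for t, continuous v}) ->
    (forall t, 0 <= v t) ->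
    I D0 v = (I D1 v + I D2 v)%E.
  move=> cv v0; have mv := mI v cv; rewrite /I /D0 /D1 /D2.
  rewrite (@itv_bndbnd_setU _ _ _ (BLeft s)) ?bnd_simp//.
  rewrite ge0_integral_setU //.
  - apply/measurable_EFinP; apply: measurable_funS mv => //.
    by rewrite -itv_bndbnd_setU ?bnd_simp.
  - by move=> t _; rewrite lee_fin.
  - apply/disj_setPS => t [/=]; rewrite !in_itv /= andbT => /andP[_ ts].
    by rewrite leNgt ts.
have Fge0 t : 0 <= F t by rewrite mulr_ge0 ?powR_ge0 ?expR_ge0.
have mu1 : measurable_fun `]0, s[ u.
  by apply: measurable_funS (mI u cu) => //; apply: subset_itvl.
have mu2 : measurable_fun `[s, +oo[ u.
  by apply: measurable_funS (mI u cu) => //; apply: subset_itvr; rewrite bnd_simp.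
have mF1 : measurable_fun `]0, s[ F.
  by apply: measurable_funS (mI F cFt) => //; apply: subset_itvl.
have sum1 : (s%:E * I D1 u = I D1 F + (F s)%:E)%E.
  rewrite /I -ge0_integralZl_EFin ?(ltW s0)//; last 2 first.
  - by move=> t _; rewrite lee_fin.
  - exact/measurable_EFinP.
  rewrite -int1 -ge0_integralD //.
  - apply: eq_integral => t; rewrite inE /D1 /= in_itv /= => /andP[t0 ts].
    by rewrite tu // -EFinM -EFinD; congr EFin; ring.
  - by move=> t _; rewrite lee_fin.
  - exact/measurable_EFinP.
  - move=> t; rewrite /D1 /= in_itv /= => /andP[t0 ts].
    by rewrite lee_fin mulr_ge0 // subr_ge0 ltW.
  - apply/measurable_EFinP; apply: measurable_funM => //.
    by apply: measurable_funB.
have sum2 : (I D2 F = s%:E * I D2 u + (F s)%:E)%E.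
  rewrite /I -ge0_integralZl_EFin ?(ltW s0)//; last 2 first.
  - by move=> t _; rewrite lee_fin.
  - exact/measurable_EFinP.
  rewrite -int2 -ge0_integralD //.
  - apply: eq_integral => t; rewrite inE /D2 /= in_itv /= andbT => st.
    by rewrite tu ?(lt_le_trans s0)// -EFinM -EFinD; congr EFin; ring.
  - by move=> t _; rewrite lee_fin mulr_ge0 // (ltW s0).
  - apply/measurable_EFinP; exact: measurable_funM.
  - move=> t; rewrite /D2 /= in_itv /= andbT => st.
    by rewrite lee_fin mulr_ge0 // subr_ge0.
  - apply/measurable_EFinP; apply: measurable_funM => //.
    by apply: measurable_funB.
have I0 (D : set R) : (0 <= I D u)%E.
  by apply: integral_ge0 => t _; rewrite lee_fin.
have rec : (I D0 F = s%:E * I D0 u)%E.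
  rewrite !split_int // sum2 (ge0_muleDr s%:E (I0 D1) (I0 D2)) sum1.
  by rewrite addeA [RHS]addeAC.
have -> : Gamma (s + 1) = fine (I D0 F).
  by rewrite /Gamma addrK.
rewrite rec /Gamma /Rintegral -/(I D0 u).
have := I0 D0.
case: (I _ u) => [r _| _|] //=.
by rewrite mulr0 gt0_muley ?lte_fin.
Qed.

(** * Grid points and interpolants *)

Lemma node0 (R : realType) (h : R) : node h 0 = 0.
Proof. exact: mul0r. Qed.

Lemma node1 (R : realType) (h : R) : node h 1 = h.
Proof. exact: mul1r. Qed.

Lemma nodeS (R : realType) (h : R) (i : nat) : node h i.+1 = node h i + h.
Proof. by rewrite /node -natr1 mulrDl mul1r. Qed.

Lemma node_pred (R : realType) (h : R) (j : nat) : (0 < j)%N ->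
  node h j = node h j.-1 + h.
Proof. by case: j => // j _; exact: nodeS. Qed.

Lemma node_lt (R : realType) (h : R) (i l : nat) : 0 < h ->
  (node h i < node h l) = (i < l)%N.
Proof. by move=> h0; rewrite /node ltr_pM2r // ltr_nat. Qed.

Lemma node_le (R : realType) (h : R) (i l : nat) : 0 < h ->
  (node h i <= node h l) = (i <= l)%N.
Proof. by move=> h0; rewrite /node ler_pM2r // ler_nat. Qed.

Lemma sumr_telescope_pred (R : realType) (u : nat -> R) (m : nat) : (1 < m)%N ->
  \sum_(2 <= j < m) (u j - u j.-1) = u m.-1 - u 1%N.
Proof.
case: m => [|[|m]] // _; elim: m => [|m IH]; first by rewrite big_geq ?subrr.
by rewrite big_nat_recr //= IH addrC subrKA.
Qed.

Lemma interp1E (R : realType) (h : R) (phi : R -> R) : 0 < h ->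
  interp1 h phi = fun t => phi 0 + (phi h - phi 0) / h * t.
Proof.
move=> h0; apply/funext => t; rewrite /interp1 node0 node1.
by field; rewrite gt_eqF.
Qed.

Lemma interp2E (R : realType) (h : R) (phi : R -> R) (j : nat) : 0 < h ->
  exists A B C, interp2 h phi j = fun t => A + B * t + C * t ^+ 2.
Proof.
move=> h0; rewrite /interp2.
move: (node h j.-2) (node h j.-1) (node h j) => x y z.
pose u := phi x / (2 * h ^+ 2); pose v := phi y / h ^+ 2.
pose w := phi z / (2 * h ^+ 2).
exists (u * (y * z) - v * (x * z) + w * (x * y)).
exists (v * (x + z) - u * (y + z) - w * (x + y)), (u - v + w).
by apply/funext => t; rewrite /u /v /w; field; rewrite gt_eqF.
Qed.

Lemma interp2_nodes (R : realType) (h : R) (phi : R -> R) (j : nat) :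
  0 < h -> (1 < j)%N ->
  [/\ interp2 h phi j (node h j.-2) = phi (node h j.-2),
      interp2 h phi j (node h j.-1) = phi (node h j.-1) &
      interp2 h phi j (node h j) = phi (node h j)].
Proof.
move=> h0; case: j => [|[|j]] // _; have hn0 : h != 0 by rewrite gt_eqF.
by split; rewrite /interp2 /= !nodeS; field.
Qed.

Lemma interp1_error (R : realType) (h M : R) (phi f1 f2 : R -> R) : 0 < h ->
  has_deriv_on 0 h phi f1 -> has_deriv_on 0 h f1 f2 ->
  (forall t, t \in `]0, h[ -> `|f2 t| <= M) ->
  forall t, t \in `]0, h[ -> `|phi t - interp1 h phi t| <= M / 2 * (t * (h - t)).
Proof.
move=> h0 d0 d1 f2M t th; rewrite interp1E //.
have := linear_interpolation_bound (A := phi 0) (B := (phi h - phi 0) / h)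
  d0 d1 f2M _ _ th.
rewrite subr0; apply; first by rewrite mulr0 addr0.
by rewrite divfK ?gt_eqF // addrC subrK.
Qed.

Lemma interp2_error (R : realType) (h M : R) (phi f1 f2 f3 : R -> R) (j : nat) :
  0 < h -> (1 < j)%N ->
  has_deriv_on (node h j.-2) (node h j) phi f1 ->
  has_deriv_on (node h j.-2) (node h j) f1 f2 ->
  has_deriv_on (node h j.-2) (node h j) f2 f3 ->
  (forall t, t \in `](node h j.-2), (node h j)[ -> `|f3 t| <= M) ->
  forall t, t \in `](node h j.-1), (node h j)[ ->
    `|phi t - interp2 h phi j t| <=
      M / 6 * ((t - node h j.-2) * (t - node h j.-1) * (node h j - t)).
Proof.
move=> h0 j1 d0 d1 d2 f3M t tj; have [] := interp2_nodes phi h0 j1.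
have [A [B [C ->]]] := interp2E phi j h0 => e0 e1 e2.
apply: (quadratic_interpolation_bound _ d0 d1 d2 f3M) => //.
by rewrite node_lt // prednK // -ltnS prednK // (ltn_trans _ j1).
Qed.

(** * Bounds on one subinterval *)

Lemma within_continuous_section (R : realType) (A B : set R) (K : R -> R -> R)
    (x : R) :
  {within A `*` B, continuous (fun p : R * R => K p.1 p.2)} -> A x ->
  {within B, continuous (K x)}.
Proof.
move=> /subspace_continuousP cK Ax; apply/subspace_continuousP => t Bt.
have cpair : (fun s : R => (x, s)) @ within B (nbhs t) -->
    within (A `*` B) (nbhs (x, t)).
  have c : (fun s : R => (x, s)) @ nbhs t --> (x, t).
    have cst_id := @cvg_pair _ _ _ (nbhs t) (nbhs x) (nbhs t) _ _ _ (fun=> x) id.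
    by apply: cst_id; [exact: cvg_cst|exact: cvg_id].
  move=> P ABP.
  have near_t : \forall s \near t, (A `*` B) (x, s) -> P (x, s) := c _ ABP.
  change (\forall s \near t, B s -> P (x, s)).
  by apply: filterS near_t => s H Bs; apply: H; split.
exact: cvg_comp cpair (cK (x, t) (conj Ax Bt)).
Qed.

Section pieces.
Context (R : realType).
Variables (h alpha : R) (phi phi1 p p1 : R -> R) (k j : nat).
Hypotheses (h0 : 0 < h) (j0 : (0 < j)%N) (jk : (j <= k)%N).
Local Notation a := (node h j.-1).
Local Notation b := (node h j).
Local Notation c := (node h k).
Hypotheses (dphi : has_deriv_on a b phi phi1).
Hypotheses (dp : forall x : R, is_derive x 1 p (p1 x)).

Let ab : a < b. Proof. by rewrite node_lt // prednK. Qed.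

(** Inside the segment the relative derivative in the Caputo piece is the
    ordinary derivative of phi - p, so the integration by parts applies. *)
Lemma caputo_piece_bound (g G : R -> R) :
  0 < alpha -> alpha < 1 ->
  {within `[a, b], continuous phi1} -> continuous p1 ->
  phi a = p a -> phi b = p b ->
  (forall t, t \in `]a, b[ ->
    alpha * (c - t) `^ (- alpha - 1) * `|phi t - p t| <= g t) ->
  {in `]a, b[, continuous g} ->
  (forall t : R, t \in `]a, b[ -> is_derive t 1 G (g t)) ->
  {within `[a, b], continuous G} ->
  `|caputo_piece h alpha phi p k j| <= G b - G a.
Proof.
move=> alpha0 alpha1 cphi1 cp1 pa pb eg cg dG cG.
have [ce de] := has_deriv_onB dphi dp.
have cde : {within `[a, b], continuous (fun t => phi1 t - p1 t)}.
  move=> t; apply: cvgB; first exact: cphi1.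
  exact: continuous_subspaceT.
have [cdeoo _ _] := (continuous_within_itvP _ ab).1 cde.
rewrite /caputo_piece.
rewrite (Rintegral_itvcc_oo
  (g := fun t => (c - t) `^ (- alpha) * (phi1 t - p1 t))).
- apply: (weighted_integral_bound alpha0 alpha1 ab _ ce de cdeoo _ _ _ eg) => //.
  + by rewrite node_le.
  + move=> t tab; apply: (within_continuous_bounded (ltW ab) cde).
    exact: subset_itv_oo_cc.
  + by rewrite pa subrr.
  + by rewrite pb subrr.
- move=> t tab; congr (_ * _).
  by apply: derive_within_interior (de t tab); exact: interior_itvcc.
- move=> t tab; apply: cvgM; last exact: cdeoo.
  apply: continuous_powR_subl.
  move: tab; rewrite in_itv /= => /andP[_ tb].
  by rewrite (lt_le_trans tb) // node_le.
Qed.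

Lemma kernel_piece_bound (K : R -> R -> R) (M B : R) :
  {within `[a, b], continuous (K c)} ->
  (forall t, t \in `[a, b] -> `|K c t| <= M) ->
  (forall t, t \in `[a, b] -> `|phi t - p t| <= B) ->
  `|kernel_piece h K phi p k j| <= M * B * h.
Proof.
move=> cK KM eB; have [ce _] := has_deriv_onB dphi dp.
have cKe : {within `[a, b], continuous (fun t => K c t * (phi t - p t))}.
  by move=> t; apply: cvgM; [exact: cK|exact: ce].
have intKe : lebesgue_measure.-integrable `[a, b]
    (EFin \o (fun t => K c t * (phi t - p t))).
  by apply: continuous_compact_integrable => //; exact: segment_compact.
have intc : lebesgue_measure.-integrable `[a, b] (EFin \o (fun=> M * B)).
  apply: continuous_compact_integrable; first exact: segment_compact.
  by apply: continuous_subspaceT => t; exact: cvg_cst.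
rewrite /kernel_piece (le_trans (le_normr_Rintegral _ intKe)) //.
have -> : M * B * h = (\int[lebesgue_measure]_(t in `[a, b]) (M * B))%R.
  rewrite Rintegral_cst //= lebesgue_measure_itv /= lte_fin ab.
  congr (_ * _); rewrite -EFinB /=.
  by rewrite [X in X - _](node_pred h j0) addrC addKr.
apply: le_Rintegral => //; first exact: integrable_norm.
by move=> t /= tab; rewrite normrM ler_pM ?KM ?eB.
Qed.

End pieces.

(** The constant of integration is chosen so that this primitive of the power
    vanishes at c for positive q. *)
Lemma is_derive_powR_primitive (R : realType) (c q t : R) : q != 0 -> t < c ->
  is_derive t 1 (fun x => - ((c - x) `^ q / q)) ((c - t) `^ (q - 1)).
Proof.
move=> q0 tc; have dt := is_derive_powR_subl q tc.
by apply: is_derive_eq; rewrite /GRing.scale /=; field.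
Qed.

(** On the singular subinterval the error bound is expanded in powers of
    u = c - t; the kernel turns q u^(i+1) into alpha q u^(i - alpha), whose
    integral over 0 <= u <= h is alpha q h^(i + 1 - alpha) / (i + 1 - alpha). *)
Lemma caputo_piece_last (R : realType) (h alpha q0 q1 q2 : R)
    (phi phi1 p p1 : R -> R) (k : nat) :
  0 < h -> (0 < k)%N -> 0 < alpha -> alpha < 1 ->
  has_deriv_on (node h k.-1) (node h k) phi phi1 ->
  {within `[node h k.-1, node h k], continuous phi1} ->
  (forall x : R, is_derive x 1 p (p1 x)) -> continuous p1 ->
  phi (node h k.-1) = p (node h k.-1) -> phi (node h k) = p (node h k) ->
  (forall t, t \in `](node h k.-1), (node h k)[ -> let u := node h k - t in
     `|phi t - p t| <= q0 * u + q1 * u ^+ 2 + q2 * u ^+ 3) ->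
  `|caputo_piece h alpha phi p k k| <=
    alpha * (q0 / (1 - alpha) * h `^ (1 - alpha) +
             q1 / (2 - alpha) * h `^ (2 - alpha) +
             q2 / (3 - alpha) * h `^ (3 - alpha)).
Proof.
move=> h0 k0 a0 a1 dphi cphi1 dp cp1 pa pb eq; set c := node h k.
have ab : node h k.-1 < c by rewrite node_lt // prednK.
pose P (q t : R) := - ((c - t) `^ q / q).
have P1 : 1 - alpha != 0 by rewrite gt_eqF // subr_gt0.
have P2 : 2 - alpha != 0 by rewrite gt_eqF // subr_gt0; lra.
have P3 : 3 - alpha != 0 by rewrite gt_eqF // subr_gt0; lra.
pose g t := alpha * (q0 * (c - t) `^ (1 - alpha - 1) +
  q1 * (c - t) `^ (2 - alpha - 1) + q2 * (c - t) `^ (3 - alpha - 1)).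
pose G t := alpha * (q0 * P (1 - alpha) t + q1 * P (2 - alpha) t +
  q2 * P (3 - alpha) t).
have tc t : t \in `](node h k.-1), c[ -> t < c.
  by rewrite in_itv /= => /andP[].
have -> : alpha * (q0 / (1 - alpha) * h `^ (1 - alpha) +
             q1 / (2 - alpha) * h `^ (2 - alpha) +
             q2 / (3 - alpha) * h `^ (3 - alpha)) = G c - G (node h k.-1).
  have ch : c - node h k.-1 = h by rewrite /c (node_pred h k0) addrC addKr.
  by rewrite /G /P ch subrr !powR0 //; field; rewrite P1 P2 P3.
apply: (caputo_piece_bound h0 k0 (leqnn k) dphi dp (g := g) (G := G)) => //.
- move=> t tab; have u0 : 0 < c - t by rewrite subr_gt0 tc.
  apply: le_trans (ler_wpM2l _ (eq t tab)) _.
    by rewrite mulr_ge0 ?powR_ge0 // ltW.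
  rewrite -/c /g.
  have -> : 3 - alpha - 1 = - alpha - 1 + 1 + 1 + 1 by ring.
  have -> : 2 - alpha - 1 = - alpha - 1 + 1 + 1 by ring.
  have -> : 1 - alpha - 1 = - alpha - 1 + 1 by ring.
  by apply: eq_ler; rewrite !powRD1 //; ring.
- move=> t tab; have cq q : {for t, continuous (fun x => (c - x) `^ q)}.
    by apply: continuous_powR_subl; exact: tc.
  by apply: cvgMr; apply: cvgD; [apply: cvgD|]; apply: cvgMr; exact: cq.
- move=> t /tc tlt; have d1 := is_derive_powR_primitive P1 tlt.
  have d2 := is_derive_powR_primitive P2 tlt.
  have d3 := is_derive_powR_primitive P3 tlt.
  by apply: is_derive_eq; rewrite /g /GRing.scale /=; ring.
- have cP q : 0 < q -> {within `[node h k.-1, c], continuous (P q)}.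
    move=> q_gt0 t; apply: cvgN; apply: cvgMl.
    exact: within_continuous_powR_subl.
  by move=> t; apply: cvgMr; apply: cvgD; [apply: cvgD|]; apply: cvgMr;
    apply: cP; lra.
Qed.

(** The kernel alpha (c - t)^(-alpha-1) is the derivative of (c - t)^(-alpha),
    so a uniform error bound gives a difference that telescopes in j. *)
Lemma caputo_piece_mid (R : realType) (h alpha B : R)
    (phi phi1 p p1 : R -> R) (k j : nat) :
  0 < h -> (0 < j)%N -> (j < k)%N -> 0 < alpha -> alpha < 1 ->
  has_deriv_on (node h j.-1) (node h j) phi phi1 ->
  {within `[node h j.-1, node h j], continuous phi1} ->
  (forall x : R, is_derive x 1 p (p1 x)) -> continuous p1 ->
  phi (node h j.-1) = p (node h j.-1) -> phi (node h j) = p (node h j) ->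
  (forall t, t \in `](node h j.-1), (node h j)[ -> `|phi t - p t| <= B) ->
  `|caputo_piece h alpha phi p k j| <=
    B * (node h k - node h j) `^ (- alpha) -
    B * (node h k - node h j.-1) `^ (- alpha).
Proof.
move=> h0 j0 jk a0 a1 dphi cphi1 dp cp1 pa pb eB; set c := node h k.
have ab : node h j.-1 < node h j by rewrite node_lt // prednK.
have bc : node h j < c by rewrite node_lt.
have tc t : t \in `[node h j.-1, node h j] -> t < c.
  by rewrite in_itv /= => /andP[_ tb]; exact: le_lt_trans bc.
have tc' t : t \in `](node h j.-1), (node h j)[ -> t < c.
  by move=> tab; apply: tc; exact: subset_itv_oo_cc.
have dG t : t < c -> is_derive t 1 (fun x => B * (c - x) `^ (- alpha))
    (alpha * (c - t) `^ (- alpha - 1) * B).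
  move=> tlt; have dt := is_derive_powR_subl (- alpha) tlt.
  by apply: is_derive_eq; rewrite /GRing.scale /=; ring.
apply: (caputo_piece_bound h0 j0 (ltnW jk) dphi dp
  (g := fun t => alpha * (c - t) `^ (- alpha - 1) * B)
  (G := fun t => B * (c - t) `^ (- alpha))) => //.
- by move=> t tab; rewrite ler_wpM2l ?eB // mulr_ge0 ?powR_ge0 // ltW.
- move=> t /tc' tlt; apply: cvgMl; apply: cvgMr.
  exact: continuous_powR_subl.
- by move=> t /tc' /dG.
- by apply: derivable_within_continuous => t /tc /dG.
Qed.

(** The kernel is increasing in t, hence at most its value at x_1 = h. *)
Lemma caputo_piece_first (R : realType) (h alpha M : R)
    (phi phi1 p p1 : R -> R) (k : nat) :
  0 < h -> (1 < k)%N -> 0 < alpha -> alpha < 1 -> 0 <= M ->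
  has_deriv_on 0 h phi phi1 -> {within `[0, h], continuous phi1} ->
  (forall x : R, is_derive x 1 p (p1 x)) -> continuous p1 ->
  phi 0 = p 0 -> phi h = p h ->
  (forall t, t \in `]0, h[ -> `|phi t - p t| <= M * (t * (h - t))) ->
  `|caputo_piece h alpha phi p k 1| <=
    alpha * (node h k - node h 1) `^ (- alpha - 1) * M * (h ^+ 3 / 6).
Proof.
move=> h0 k1 a0 a1 M0 dphi cphi1 dp cp1 pa pb eM; set c := node h k.
have bc : h < c by rewrite -[h]node1 node_lt.
pose w := alpha * (c - node h 1) `^ (- alpha - 1).
pose G t := w * M * (h * t ^+ 2 / 2 - t ^+ 3 / 3).
have dG (t : R) : is_derive t 1 G (w * M * (t * (h - t))).
  apply: is_derive_eq; rewrite /GRing.scale /=.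
  by field.
have -> : alpha * (c - node h 1) `^ (- alpha - 1) * M * (h ^+ 3 / 6) =
    G (node h 1) - G (node h 0).
  by rewrite /G -/w node0 node1; field.
have n10 : node h 1%N.-1 = 0 by exact: node0.
apply: (@caputo_piece_bound _ h alpha phi phi1 p p1 k 1 h0 (ltn0Sn 0) (ltnW k1)
   _ _ (fun t => w * M * (t * (h - t)))); rewrite ?n10 ?node1 //.
- move=> t tab.
  have [t0 th] : 0 < t /\ t < h by move: tab; rewrite in_itv /= => /andP[].
  rewrite -/c -[leRHS]mulrA.
  apply: ler_pM; rewrite ?mulr_ge0 ?powR_ge0 ?(ltW a0)//.
    by rewrite /w ler_wpM2l ?(ltW a0)// node1 ge0_ler_powRN ?subr_gt0//; lra.
  exact: eM.
- move=> t _; apply: cvgMr; apply: cvgM; first exact: cvg_id.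
  by apply: cvgB; [exact: cvg_cst|exact: cvg_id].
- by apply: derivable_within_continuous => t _; have := dG t.
Qed.

(** * Summation over the grid *)

Section scheme.
Context (R : realType).
Variables (h alpha M : R) (k : nat) (K : R -> R -> R) (phi : R -> R).
Local Notation X := (node h k).
Local Notation f := (fun i => derive_withinn `[0, X] i phi).
Hypotheses (h0 : 0 < h) (k0 : (0 < k)%N) (X1 : X <= 1).
Hypotheses (a0 : 0 < alpha) (a1 : alpha < 1).
Hypothesis phi_C3 : class_C 3 `[0, X] phi.
Hypothesis K_cont :
  {within `[0, 1] `*` `[0, 1], continuous (fun p : R * R => K p.1 p.2)}.
Hypothesis K_bound : forall x t : R,
  0 <= x -> x <= 1 -> 0 <= t -> t <= 1 -> `|K x t| <= M.

Let X0 : 0 < X. Proof. by rewrite -(node0 h) node_lt. Qed.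

Let node_ge0 j : 0 <= node h j.
Proof. by rewrite -(node0 h) node_le. Qed.

Let node_leX j : (j <= k)%N -> node h j <= X.
Proof. by rewrite node_le. Qed.

Let df (i a b : nat) : (i < 3)%N -> (b <= k)%N ->
  has_deriv_on (node h a) (node h b) (f i) (f i.+1).
Proof.
move=> i3 bk; apply: has_deriv_onS (node_ge0 a) (node_leX bk) _.
exact: class_C_has_deriv_on phi_C3 i3.
Qed.

Let cf (i a b : nat) : (i <= 3)%N -> (b <= k)%N ->
  {within `[node h a, node h b], continuous (f i)}.
Proof.
move=> i3 bk; have [_ /(_ i i3)] := phi_C3; apply: continuous_subspaceW.
by apply: subset_itv; rewrite bnd_simp; [exact: node_ge0|exact: node_leX].
Qed.

Let f_le i a b t : (i <= 3)%N -> (a <= b)%N -> (b <= k)%N ->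
  t \in `[node h a, node h b] -> `|f i t| <= maxabs (node h a) (node h b) (f i).
Proof.
move=> i3 ab bk; apply: within_continuous_bounded; first by rewrite node_le.
exact: cf.
Qed.

Let maxabs_ge0 i a b : (i <= 3)%N -> (a <= b)%N -> (b <= k)%N ->
  0 <= maxabs (node h a) (node h b) (f i).
Proof.
move=> i3 ab bk; apply: le_trans (normr_ge0 (f i (node h a))) _.
by apply: f_le => //; rewrite in_itv /= lexx node_le.
Qed.

Let interp1_error_scheme (b : nat) t : (0 < b)%N -> (b <= k)%N -> t \in `]0, h[ ->
  `|phi t - interp1 h phi t| <=
    maxabs (node h 0) (node h b) (f 2%N) / 2 * (t * (h - t)).
Proof.
move=> b0 bk; have d0 := @df 0 0 1 isT k0; have d1 := @df 1 0 1 isT k0.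
rewrite node0 node1 in d0 d1; apply: (interp1_error h0 d0 d1) => {}t.
rewrite in_itv /= => /andP[t0 th]; apply: (@f_le 2 0 b) => //.
by rewrite node0 in_itv /= ltW // (le_trans (ltW th)) // -[leLHS]node1 node_le.
Qed.

Let interp2_error_scheme j t : (1 < j)%N -> (j <= k)%N ->
  t \in `](node h j.-1), (node h j)[ ->
  `|phi t - interp2 h phi j t| <= maxabs (node h 0) X (f 3%N) / 6 *
      ((t - node h j.-2) * (t - node h j.-1) * (node h j - t)).
Proof.
move=> j1 jk; apply: (interp2_error h0 j1 (@df 0 _ _ isT jk) (@df 1 _ _ isT jk)
  (@df 2 _ _ isT jk)) => {}t; rewrite in_itv /= => /andP[t0 tj].
apply: (@f_le 3 0 k) => //; rewrite in_itv /= node0.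
by rewrite (le_trans (node_ge0 _) (ltW t0)) (le_trans (ltW tj)) ?node_leX.
Qed.

(** The factors are bounded by t - x_(j-2) <= 2 h and, by the arithmetic-geometric
    mean inequality, (t - x_(j-1))(x_j - t) <= h^2 / 4. *)
Let interp2_error_cst j t : (1 < j)%N -> (j <= k)%N ->
  t \in `[(node h j.-1), (node h j)] ->
  `|phi t - interp2 h phi j t| <= maxabs (node h 0) X (f 3%N) / 12 * h ^+ 3.
Proof.
move=> j1 jk; have [_ e1 e2] := interp2_nodes phi h0 j1.
have m0 : 0 <= maxabs (node h 0) X (f 3%N) / 12 * h ^+ 3.
  by rewrite !mulr_ge0 ?maxabs_ge0 ?exprn_ge0 ?ltW.
rewrite in_itv /= => /andP[].
rewrite le_eqVlt => /predU1P[<- _|]; first by rewrite e1 subrr normr0.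
move=> t1; rewrite le_eqVlt => /predU1P[->|t2]; first by rewrite e2 subrr normr0.
have tin : t \in `](node h j.-1), (node h j)[ by rewrite in_itv /= t1.
apply: le_trans (interp2_error_scheme j1 jk tin) _.
have -> : maxabs (node h 0) X (f 3%N) / 12 * h ^+ 3 =
  maxabs (node h 0) X (f 3%N) / 6 * (h ^+ 3 / 2) by field.
rewrite ler_wpM2l ?divr_ge0 ?maxabs_ge0 //.
move: t1 t2; rewrite [node h j](node_pred h (ltnW j1)).
rewrite [node h j.-1](node_pred h (j := j.-1)); last by rewrite -ltnS prednK // ltnW.
move: (node h j.-2) => y; move=> t1 t2.
have -> : (t - y) * (t - (y + h)) * (y + h + h - t) =
  (t - y) * ((t - (y + h)) * (y + h + h - t)) by ring.
(* y is x_(j-2), so that x_(j-1) = y + h and x_j = y + h + h. *)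
have -> : h ^+ 3 / 2 = (2 * h) * (h ^+ 2 / 4) by field.
apply: ler_pM; [lra| |lra|].
  by rewrite mulr_ge0; lra.
rewrite -subr_ge0.
have -> : h ^+ 2 / 4 - (t - (y + h)) * (y + h + h - t) =
  (t - (y + h) - h / 2) ^+ 2 by field.
exact: sqr_ge0.
Qed.

Let interp1_is_derive (x : R) : is_derive x 1 (interp1 h phi) ((phi h - phi 0) / h).
Proof.
by rewrite interp1E //; apply: is_derive_eq; rewrite /GRing.scale /=; ring.
Qed.

Let interp1_0 : phi 0 = interp1 h phi 0.
Proof. by rewrite interp1E // mulr0 addr0. Qed.

Let interp1_h : phi h = interp1 h phi h.
Proof. by rewrite interp1E // divfK ?gt_eqF // addrC subrK. Qed.

Let K_cont_on a b : (b <= k)%N -> {within `[node h a, node h b], continuous (K X)}.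
Proof.
move=> bk; have X01 : `[0, 1]%classic X by rewrite /= in_itv /= (ltW X0).
apply: continuous_subspaceW (within_continuous_section K_cont X01).
apply: subset_itv; rewrite bnd_simp ?node_ge0 //.
exact: le_trans (node_leX bk) X1.
Qed.

Let K_bound_on a b t : (b <= k)%N -> t \in `[node h a, node h b] -> `|K X t| <= M.
Proof.
move=> bk; rewrite in_itv /= => /andP[at_ tb]; apply: K_bound => //.
- exact: le_trans (node_ge0 a) at_.
- by rewrite (le_trans tb) // (le_trans (node_leX bk)).
Qed.

Lemma kernel_piece1_bound : `|kernel_piece h K phi (interp1 h phi) k 1| <=
  M / 2 * maxabs (node h 0) (node h 1) (f 2%N) * node h 1 * h ^+ 2.
Proof.
set M2 := maxabs _ _ _; have M20 : 0 <= M2 by exact: maxabs_ge0.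
have B0 : 0 <= M2 / 2 * h ^+ 2 by rewrite mulr_ge0 ?divr_ge0 ?exprn_ge0 // ltW.
have -> : M / 2 * M2 * node h 1 * h ^+ 2 = M * (M2 / 2 * h ^+ 2) * h.
  by rewrite node1; ring.
apply: (kernel_piece_bound h0 (ltn0Sn 0) (@df 0 0 1 isT k0) interp1_is_derive).
- exact: K_cont_on.
- by move=> t; exact: (@K_bound_on 0 1).
move=> t; rewrite node0 node1 in_itv /= => /andP[].
rewrite le_eqVlt => /predU1P[<- _|]; first by rewrite -interp1_0 subrr normr0.
move=> t0; rewrite le_eqVlt => /predU1P[->|th].
  by rewrite -interp1_h subrr normr0.
have tin : t \in `]0, h[ by rewrite in_itv /= t0.
apply: le_trans (@interp1_error_scheme 1 t isT k0 tin) _.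
rewrite ler_wpM2l ?divr_ge0 // expr2.
by apply: ler_pM; lra.
Qed.

Lemma kernel_piece2_bound j : (1 < j)%N -> (j <= k)%N ->
  `|kernel_piece h K phi (interp2 h phi j) k j| <=
  M / 12 * maxabs (node h 0) X (f 3%N) * h ^+ 3 * (node h j - node h j.-1).
Proof.
move=> j1 jk; set M3 := maxabs _ _ _; have M30 : 0 <= M3 by exact: maxabs_ge0.
have [A [B [C pE]]] := interp2E phi j h0.
have dp (x : R) : is_derive x 1 (interp2 h phi j) (B + 2 * C * x).
  by rewrite pE; apply: is_derive_eq; rewrite /GRing.scale /=; ring.
have -> : M / 12 * M3 * h ^+ 3 * (node h j - node h j.-1) =
    M * (M3 / 12 * h ^+ 3) * h.
  by rewrite [node h j](node_pred h (ltnW j1)); ring.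
apply: (kernel_piece_bound h0 (ltnW j1) (@df 0 _ _ isT jk) dp).
- exact: K_cont_on.
- by move=> t; exact: K_bound_on.
- by move=> t; exact: interp2_error_cst.
Qed.

Lemma kernel_sum_bound :
  `|\sum_(2 <= j < k.+1) kernel_piece h K phi (interp2 h phi j) k j| <=
  M / 12 * maxabs (node h 0) X (f 3%N) * (X - node h 1) * h ^+ 3.
Proof.
rewrite (le_trans (ler_norm_sum _ _ _)) //.
set C := M / 12 * maxabs (node h 0) X (f 3%N).
have -> : C * (X - node h 1) * h ^+ 3 =
    \sum_(2 <= j < k.+1) C * h ^+ 3 * (node h j - node h j.-1).
  by rewrite -mulr_sumr sumr_telescope_pred //; ring.
apply: ler_sum_nat => j /andP[j1 jk].
exact: kernel_piece2_bound.
Qed.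

(** With u = h - t the remainder t (h - t) is h u - u^2. *)
Lemma caputo_piece1_single_bound : k = 1%N ->
  `|caputo_piece h alpha phi (interp1 h phi) k 1| <=
  alpha / (2 * ((2 - alpha) * (1 - alpha))) *
    maxabs (node h 0) (node h 1) (f 2%N) * h `^ (2 - alpha).
Proof.
move=> k1; set M2 := maxabs _ _ _.
have d0 := @df 0 0 1 isT k0; have c1 := @cf 1 0 1 isT k0.
have a2 : 1 - alpha != 0 by rewrite gt_eqF // subr_gt0.
have a3 : 2 - alpha != 0 by rewrite gt_eqF // subr_gt0 (lt_trans a1) // ltr1n.
have a4 : 3 - alpha != 0 by rewrite gt_eqF // subr_gt0 (lt_trans a1) // ltr1n.
have e t : t \in `](node h 1.-1), (node h 1)[ -> let u := node h 1 - t in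
    `|phi t - interp1 h phi t| <=
      (M2 / 2 * h) * u + (- (M2 / 2)) * u ^+ 2 + 0 * u ^+ 3.
  rewrite node0 node1 => tin /=.
  apply: le_trans (@interp1_error_scheme 1 t isT k0 tin) _.
  by rewrite -/M2; apply: eq_ler; ring.
have -> : caputo_piece h alpha phi (interp1 h phi) k 1 =
    caputo_piece h alpha phi (interp1 h phi) 1 1 by rewrite k1.
have c0 : phi (node h 0) = interp1 h phi (node h 0) by rewrite node0.
have ch : phi (node h 1) = interp1 h phi (node h 1) by rewrite node1.
have cst_cont : continuous (fun _ : R => (phi h - phi 0) / h).
  by move=> x; exact: cvg_cst.
apply: le_trans (caputo_piece_last h0 (ltn0Sn 0) a0 a1 d0 c1 interp1_is_derive
  cst_cont c0 ch e) _.
have -> : h `^ (2 - alpha) = h `^ (1 - alpha) * h.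
  by rewrite -powRD1 //; congr (_ `^ _); ring.
by apply: eq_ler; field; rewrite a2 a3 a4.
Qed.

Lemma caputo_piece1_bound : (1 < k)%N ->
  `|caputo_piece h alpha phi (interp1 h phi) k 1| <=
  alpha / 12 * maxabs (node h 0) X (f 2%N) *
    (X - node h 1) `^ (- alpha - 1) * h ^+ 3.
Proof.
move=> k1; set M2 := maxabs _ _ _; have M20 : 0 <= M2 by exact: maxabs_ge0.
have d0 := @df 0 0 1 isT k0; have c1 := @cf 1 0 1 isT k0.
rewrite node0 [X in has_deriv_on _ X](node1 h) in d0.
rewrite node0 [X in `[_, X]](node1 h) in c1.
have cst_cont : continuous (fun _ : R => (phi h - phi 0) / h).
  by move=> x; exact: cvg_cst.
have e t : t \in `]0, h[ ->
    `|phi t - interp1 h phi t| <= M2 / 2 * (t * (h - t)).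
  exact: interp1_error_scheme.
apply: le_trans (caputo_piece_first h0 k1 a0 a1 _ d0 c1 interp1_is_derive
  cst_cont interp1_0 interp1_h e) _; first by rewrite divr_ge0.
by apply: eq_ler; field.
Qed.

Let interp2_caputo_data j : (1 < j)%N -> (j <= k)%N ->
  exists2 p1 : R -> R, continuous p1 &
    [/\ forall x : R, is_derive x 1 (interp2 h phi j) (p1 x),
        phi (node h j.-1) = interp2 h phi j (node h j.-1) &
        phi (node h j) = interp2 h phi j (node h j)].
Proof.
move=> j1 jk; have [_ e1 e2] := interp2_nodes phi h0 j1.
have [A [B [C pE]]] := interp2E phi j h0.
exists (fun x => B + 2 * C * x).
  move=> x; apply: cvgD; first exact: cvg_cst.
  by apply: cvgMr; exact: cvg_id.
split => // x.
by rewrite pE; apply: is_derive_eq; rewrite /GRing.scale /=; ring.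
Qed.

Lemma caputo_piece2_bound j : (1 < j)%N -> (j < k)%N ->
  `|caputo_piece h alpha phi (interp2 h phi j) k j| <=
  maxabs (node h 0) X (f 3%N) / 12 * h ^+ 3 *
    ((X - node h j) `^ (- alpha) - (X - node h j.-1) `^ (- alpha)).
Proof.
move=> j1 jk; have [p1 cp1 [dp e1 e2]] := interp2_caputo_data j1 (ltnW jk).
rewrite mulrBr.
apply: (caputo_piece_mid h0 (ltnW j1) jk a0 a1 (@df 0 _ _ isT (ltnW jk))
  (@cf 1 _ _ isT (ltnW jk)) dp cp1 e1 e2) => t tin.
apply: interp2_error_cst => //; first exact: ltnW.
exact: subset_itv_oo_cc.
Qed.

(** With u = x_k - t the remainder (t - x_(k-2))(t - x_(k-1))(x_k - t) is
    (2 h - u)(h - u) u = 2 h^2 u - 3 h u^2 + u^3. *)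
Lemma caputo_piece2_last_bound : (1 < k)%N ->
  `|caputo_piece h alpha phi (interp2 h phi k) k k| <=
  alpha / (3 * (1 - alpha) * (2 - alpha)) * (1 / 2 + 1 / (3 - alpha)) *
    maxabs (node h 0) X (f 3%N) * h `^ (3 - alpha).
Proof.
move=> k1; have [p1 cp1 [dp e1 e2]] := interp2_caputo_data k1 (leqnn k).
set M3 := maxabs _ _ _.
have a2 : 1 - alpha != 0 by rewrite gt_eqF // subr_gt0.
have a3 : 2 - alpha != 0 by rewrite gt_eqF // subr_gt0 (lt_trans a1) // ltr1n.
have a4 : 3 - alpha != 0 by rewrite gt_eqF // subr_gt0 (lt_trans a1) // ltr1n.
have e t : t \in `](node h k.-1), X[ -> let u := X - t in
    `|phi t - interp2 h phi k t| <=
      (M3 / 6 * (2 * h ^+ 2)) * u + (- (M3 / 6 * (3 * h))) * u ^+ 2 +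
      M3 / 6 * u ^+ 3.
  move=> tin /=; apply: le_trans (interp2_error_scheme k1 (leqnn k) tin) _.
  rewrite -/M3 [node h k](node_pred h (ltnW k1)).
  rewrite [node h k.-1](node_pred h (j := k.-1)); last by rewrite -ltnS prednK.
  by apply: eq_ler; ring.
apply: le_trans (caputo_piece_last h0 k0 a0 a1 (@df 0 _ _ isT (leqnn k))
  (@cf 1 _ _ isT (leqnn k)) dp cp1 e1 e2 e) _.
have -> : h `^ (3 - alpha) = h `^ (1 - alpha) * h * h.
  by rewrite -!powRD1 //; congr (_ `^ _); ring.
have -> : h `^ (2 - alpha) = h `^ (1 - alpha) * h.
  by rewrite -powRD1 //; congr (_ `^ _); ring.
by apply: eq_ler; field; rewrite a2 a3 a4.
Qed.

(** The inner subintervals contribute the 1 / 12: their bounds telescope to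
    h^(-alpha) - (x_k - x_1)^(-alpha), and the second term is dropped. *)
Lemma caputo_sum_bound : (1 < k)%N ->
  `|\sum_(2 <= j < k.+1) caputo_piece h alpha phi (interp2 h phi j) k j| <=
  (1 / 12 + alpha / (3 * (1 - alpha) * (2 - alpha)) * (1 / 2 + 1 / (3 - alpha)))
    * maxabs (node h 0) X (f 3%N) * h `^ (3 - alpha).
Proof.
move=> k1; set M3 := maxabs _ _ _; have M30 : 0 <= M3 by exact: maxabs_ge0.
set Z := alpha / _ * _; set H := h `^ _.
have -> : (1 / 12 + Z) * M3 * H = 1 / 12 * (M3 * H) + Z * M3 * H by ring.
rewrite big_nat_recr //=.
apply: le_trans (ler_normD _ _) _; apply: lerD; last first.
  exact: caputo_piece2_last_bound.
rewrite (le_trans (ler_norm_sum _ _ _)) //.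
have C0 : 0 <= M3 / 12 * h ^+ 3 by rewrite mulr_ge0 ?divr_ge0 ?exprn_ge0 // ltW.
apply: (@le_trans _ _ (\sum_(2 <= j < k) M3 / 12 * h ^+ 3 *
    ((X - node h j) `^ (- alpha) - (X - node h j.-1) `^ (- alpha)))).
  by apply: ler_sum_nat => j /andP[j1 jk]; exact: caputo_piece2_bound.
rewrite -mulr_sumr (sumr_telescope_pred (fun j => (X - node h j) `^ (- alpha))) //.
have -> : X - node h k.-1 = h by rewrite (node_pred h k0) addrC addKr.
have -> : 1 / 12 * (M3 * H) = M3 / 12 * h ^+ 3 * h `^ (- alpha).
  rewrite /H.
  have -> : 3 - alpha = - alpha + 1 + 1 + 1 by ring.
  by rewrite !powRD1 //; field.
by rewrite ler_wpM2l // gerBl powR_ge0.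
Qed.

End scheme.

Theorem theorem4p2 (R : realType) (alpha : R) (n k : nat) (h M : R)
    (phi : R -> R) (K : R -> R -> R)
    (alpha_gt0 : 0 < alpha) (alpha_lt1 : alpha < 1)
    (n_ge1 : (1 <= n)%N) (hE : h = 1 / n%:R)
    (k_ge1 : (1 <= k)%N) (k_le_n : (k <= n)%N)
    (phi_C3 : class_C 3 `[0, node h k] phi)
    (K_cont : {within `[0, 1] `*` `[0, 1], continuous (fun p : R * R => K p.1 p.2)})
    (M_gt0 : 0 < M)
    (K_bound : forall x t : R,
       0 <= x -> x <= 1 -> 0 <= t -> t <= 1 -> `|K x t| <= M) :
  let x := node h in
  let phi'' := derive_withinn `[0, x k] 2 phi in
  let phi''' := derive_withinn `[0, x k] 3 phi in
  (k = 1%N ->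
     `|scheme_error h alpha K phi 1| <=
       alpha / (2 * Gamma (3 - alpha)) * maxabs (x 0%N) (x 1%N) phi''
         * h `^ (2 - alpha)
       + M / 2 * maxabs (x 0%N) (x 1%N) phi'' * x 1%N * h ^+ 2) /\
  ((2 <= k)%N ->
     `|scheme_error h alpha K phi k| <=
       1 / Gamma (1 - alpha) *
         (alpha / 12 * maxabs (x 0%N) (x k) phi''
            * (x k - x 1%N) `^ (- alpha - 1) * h ^+ 3
          + (1 / 12 + alpha / (3 * (1 - alpha) * (2 - alpha))
                        * (1 / 2 + 1 / (3 - alpha)))
            * maxabs (x 0%N) (x k) phi''' * h `^ (3 - alpha))
       + M / 2 * maxabs (x 0%N) (x 1%N) phi'' * x 1%N * h ^+ 2
       + M / 12 * maxabs (x 0%N) (x k) phi''' * (x k - x 1%N) * h ^+ 3).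
Proof.
move=> x phi'' phi'''.
have n0 : 0 < n%:R :> R by rewrite ltr0n.
have h0 : 0 < h by rewrite hE divr_gt0.
have xk1 : x k <= 1.
  by rewrite /x /node hE mul1r ler_pdivrMr // mul1r ler_nat.
have G0 : 0 <= (Gamma (1 - alpha))^-1 by rewrite invr_ge0 Gamma_ge0.
have k1_bound := kernel_piece1_bound h0 k_ge1 xk1 phi_C3 K_cont K_bound.
split=> [k1|k2].
- subst k.
  have c1 := caputo_piece1_single_bound h0 k_ge1 alpha_gt0 alpha_lt1 phi_C3 erefl.
  rewrite /scheme_error !big_geq // addr0 subr0.
  apply: le_trans (ler_normB _ _) _; apply: lerD; last exact: k1_bound.
  rewrite normrM (ger0_norm G0).
  apply: le_trans (ler_wpM2l G0 c1) _.
  have -> : Gamma (3 - alpha) = (2 - alpha) * (1 - alpha) * Gamma (1 - alpha).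
    have a1 : 0 < 1 - alpha by rewrite subr_gt0.
    have -> : 3 - alpha = 2 - alpha + 1 by ring.
    have E2 : 2 - alpha = 1 - alpha + 1 by ring.
    rewrite Gamma_succ; last by rewrite E2 addr_gt0.
    by rewrite {2}E2 Gamma_succ // mulrA.
  rewrite /x /phi''.
  move: (maxabs _ _ _) (_ `^ _) => M2 H.
  by apply: eq_ler; rewrite !invfM; ring.
- have kS := kernel_sum_bound h0 k_ge1 xk1 phi_C3 K_cont K_bound.
  have c1 := caputo_piece1_bound h0 k_ge1 alpha_gt0 alpha_lt1 phi_C3 k2.
  have cS := caputo_sum_bound h0 k_ge1 alpha_gt0 alpha_lt1 phi_C3 k2.
  rewrite /scheme_error.
  apply: le_trans (ler_normB _ _) _; apply: lerD; last exact: kS.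
  apply: le_trans (ler_normB _ _) _; apply: lerD; last exact: k1_bound.
  rewrite normrM (ger0_norm G0) div1r ler_wpM2l //.
  apply: le_trans (ler_normD _ _) _; apply: lerD; [exact: c1|exact: cS].
Qed.
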